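(* Each connected component of the frozen boundary corresponding to an outer corner has a cusp on it. In particular, the number of cusps is equal to the number of outer corners where at least one of the slopes is a lattice slope.
   Context: Setting: random skew plane partitions with boundary $\lambda_k$ confined to a $c_k\times d_k$ box, distributed with probability proportional to $q_k^{|\pi|}$, $q_k=e^{-r_k}$, $r_k\to 0$, $r_kc_k\to C$, $r_kd_k\to D$. The scaled back walls $B_{\lambda_k}(\tau)=r_k b_{\lambda_k}(\tau/r_k)$ converge uniformly to a continuous piecewise linear function $V(\tau)$: there are $V_0<V_1<\ldots<V_n$ and slopes $\beta_1,\ldots,\beta_n\in[-1,1]$ such that $V$ is linear with slope $\beta_i$ on $[V_{i-1},V_i]$; set $\beta_0=-1$, $\beta_{n+1}=1$, and assume $\beta_i\neq\beta_{i+1}$. Slopes $\pm1$ are called lattice slopes. An outer corner is a point where $V'(\tau-)<V'(\tau+)$, i.e. a $V_i$ with $\beta_i<\beta_{i+1}$. The frozen boundary (boundary between frozen and liquid regions of the limit shape) is the set of points $(\tau,\chi)$ for which $S_{\tau,\chi}(z)=-\int_{V_0}^{\tau}-\frac12(1+V'(M))\ln(1-e^{M}z^{-1})dM+\int_{\tau}^{V_n}-\frac12(1-V'(M))\ln(1-e^{-M}z)dM-\ln(z)(\chi-\frac12V(\tau))$ has a double real critical point. It is the parametric curve $(\tau(z),\chi(z))$, $z\in\mathfrak U:=(-\infty,e^{V_0})\cup(e^{V_n},\infty)\cup\bigcup_{i:\beta_i=\pm1}(e^{V_{i-1}},e^{V_i})$, where $e^{\tau(z)}=z-\frac1{T(z)}$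 with $T(z)=\sum_{i=0}^n\frac12(\beta_{i+1}-\beta_i)\frac1{z-e^{V_i}}$, and, with $j$ such that $V_{j-1}<\tau<V_j$, $\chi(z)=-\sum_{i=1}^{j-1}\frac12(1+\beta_i)\ln\frac{ze^{-V_i}-1}{ze^{-V_{i-1}}-1}-\frac12(1+\beta_j)\ln\frac{ze^{-\tau}-1}{ze^{-V_{j-1}}-1}+\frac12(1-\beta_j)\ln\frac{ze^{-V_j}-1}{ze^{-\tau}-1}+\sum_{i=j+1}^n\frac12(1-\beta_i)\ln\frac{ze^{-V_i}-1}{ze^{-V_{i-1}}-1}-\frac12\tau+\frac12(V(V_0)+V_0)$ (with $\tau=\tau(z)$). The frozen boundary has one connected component for each outer corner where at least one of the two slopes is $\pm1$ (traced by $z$ in the corresponding intervals $(e^{V_{l-1}},e^{V_l})$ with $\beta_l=\pm1$, adjacent such intervals joined), plus one component at the bottom (from $z\notin[e^{V_0},e^{V_n}]$). A cusp is a point of the curve where $\frac{d\tau}{dz}=\frac{d\chi}{dz}=0$. *)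

(* Defs.v *)
From Stdlib Require Import Reals Lra List ClassicalDescription.
From Coquelicot Require Import Coquelicot.
Open Scope R_scope.

(* Data of the limiting back wall V: breakpoints V 0 < V 1 < ... < V n
   (V i stands for V_i) and slopes beta 1, ..., beta n (beta i = beta_i);
   v0 stands for the value V(V_0).  The boundary slopes are
   beta_0 = -1 and beta_{n+1} = 1: *)
Definition bext (n : nat) (beta : nat -> R) (i : nat) : R :=
  if Nat.eqb i 0 then -1 else if Nat.eqb i (S n) then 1 else beta i.

Definition lattice (s : R) : Prop := s = 1 \/ s = -1.

Definition Tfun (n : nat) (V beta : nat -> R) (z : R) : R :=
  sum_f_R0 (fun i => / 2 * (bext n beta (S i) - bext n beta i) / (z - exp (V i))) n.

Definition is_pole (n : nat) (V : nat -> R) (z : R) : Prop :=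
  exists i, (i <= n)%nat /\ z = exp (V i).

(* 1/T(z), extended by its limit value 0 at the poles e^{V_i} of T
   (removable singularities of z - 1/T(z)). *)
Definition invT (n : nat) (V beta : nat -> R) (z : R) : R :=
  if excluded_middle_informative (is_pole n V z) then 0 else / Tfun n V beta z.

Definition tau_of (n : nat) (V beta : nat -> R) (z : R) : R :=
  ln (z - invT n V beta z).

Definition clamp (a b t : R) : R := Rmax a (Rmin b t).

(* lg z a = ln |z e^{-a} - 1| ; the paper's ln((z e^{-b}-1)/(z e^{-a}-1))
   is read as lg z b - lg z a (real part of the logarithm). *)
Definition lg (z a : R) : R := ln (Rabs (z * exp (- a) - 1)).

(* chi(z): the paper's formula with j such that V_{j-1} < tau < V_j.
   Segment i = k+1 (from V k to V (S k)) is split at c = clamp of tau into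
   [V k, V (S k)]: the part below tau gets weight -1/2(1+beta_i), the part
   above tau gets weight 1/2(1-beta_i).  For i<j, c = V_i; for i>j,
   c = V_{i-1}; for i = j, c = tau: this is literally the paper's formula. *)
Definition chi_of (n : nat) (V beta : nat -> R) (v0 z : R) : R :=
  let t := tau_of n V beta z in
  sum_f_R0 (fun k =>
      let c := clamp (V k) (V (S k)) t in
      - / 2 * (1 + beta (S k)) * (lg z c - lg z (V k))
      + / 2 * (1 - beta (S k)) * (lg z (V (S k)) - lg z c)) (n - 1)
  - t / 2 + / 2 * (v0 + V 0%nat).

Definition in_U (n : nat) (V beta : nat -> R) (z : R) : Prop :=
  z < exp (V 0%nat) \/ exp (V n) < z \/
  exists i, (1 <= i <= n)%nat /\ lattice (beta i) /\
            exp (V (i - 1)%nat) < z < exp (V i).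

Definition join_point (n : nat) (V beta : nat -> R) (z : R) : Prop :=
  exists l, (1 <= l <= n - 1)%nat /\ beta l = -1 /\ beta (S l) = 1 /\
            z = exp (V l).

(* z is a parameter of the frozen boundary (tau(z) defined). *)
Definition curve_param (n : nat) (V beta : nat -> R) (z : R) : Prop :=
  (in_U n V beta z \/ join_point n V beta z) /\ 0 < z - invT n V beta z.

Definition cusp_param (n : nat) (V beta : nat -> R) (v0 z : R) : Prop :=
  curve_param n V beta z /\
  is_derive (tau_of n V beta) z 0 /\ is_derive (chi_of n V beta v0) z 0.

(* V_l (1 <= l <= n-1) is an outer corner with at least one lattice slope.
   (Since beta_l < beta_{l+1}, a lattice beta_l is -1, a lattice
   beta_{l+1} is 1.) *)
Definition lattice_outer_corner (n : nat) (beta : nat -> R) (l : nat) : Prop :=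
  (1 <= l <= n - 1)%nat /\ beta l < beta (S l) /\
  (lattice (beta l) \/ lattice (beta (S l))).

(* Parameter set of the connected component of the frozen boundary
   corresponding to the outer corner V_l. *)
Definition component (n : nat) (V beta : nat -> R) (l : nat) (z : R) : Prop :=
  (lattice (beta l) /\ exp (V (l - 1)%nat) < z < exp (V l)) \/
  (lattice (beta (S l)) /\ exp (V l) < z < exp (V (S l))) \/
  (lattice (beta l) /\ lattice (beta (S l)) /\ z = exp (V l)).

(* Main.v *)
Require Import Defs.
From Stdlib Require Import Reals Ranalysis5 Lra Lia List ClassicalDescription.
From Coquelicot Require Import Coquelicot.
Open Scope R_scope.

(* Put a_i = e^{V_i}, w_i = (beta_{i+1} - beta_i)/2, so T(z) = sum_i w_i / (z - a_i),
   and E = z - 1/T(z) = e^tau.  One computes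
     tau' = (T^2 + T') / (T^2 E)   and   chi' = (T^2 + T') / T + tau' / 2,
   so the cusps are the zeros of T^2 + T', i.e. of P'' for P = prod |z - a_i|^{w_i}
   (up to sign).

   Everything rests on one inequality: if g decreases on the part of the back wall to
   the left of E and increases to the right of it, then sum_i w_i g(a_i) > g(E).  This
   is summation by parts together with |beta| <= 1, and on a segment of slope +-1 that
   contains z the relevant weight vanishes, so that g may be singular at z.  With
   suitable rational g it locates E, shows that P'' is strictly monotone on each
   component of an outer corner (P'' changes sign between the ends, so it has exactly
   one zero), and excludes zeros elsewhere.  With g' = (t - E) / ((t - z1)^2 (t - z2)^2)
   it shows that two distinct cusp parameters have distinct points (tau, chi). *)

(** * Finite sums and monotonicity from a derivative *)

Lemma is_derive_sum_f_R0 (f : nat -> R -> R) (d : nat -> R) (n : nat) (x : R) :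
  (forall k, (k <= n)%nat -> is_derive (f k) x (d k)) ->
  is_derive (fun y => sum_f_R0 (fun k => f k y) n) x (sum_f_R0 d n).
Proof.
  intros H; induction n as [|n IH]; simpl.
  - now apply H.
  - apply (is_derive_plus (fun y => sum_f_R0 (fun k => f k y) n) (f (S n)));
      [apply IH; intros; apply H; lia | apply H; lia].
Qed.

Lemma sum_f_R0_ge0 (f : nat -> R) (n : nat) :
  (forall k, (k <= n)%nat -> 0 <= f k) -> 0 <= sum_f_R0 f n.
Proof.
  induction n as [|n IH]; simpl; intros H; [apply H; lia|].
  apply Rplus_le_le_0_compat; [apply IH; intros; apply H; lia | apply H; lia].
Qed.

Lemma sum_f_R0_gt0 (f : nat -> R) (n j : nat) :
  (j <= n)%nat -> (forall k, (k <= n)%nat -> 0 <= f k) -> 0 < f j ->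
  0 < sum_f_R0 f n.
Proof.
  induction n as [|n IH]; simpl; intros Hj H Hp.
  - now replace j with 0%nat in Hp by lia.
  - destruct (Nat.eq_dec j (S n)) as [->|Hne].
    + apply Rplus_le_lt_0_compat; [|exact Hp].
      apply sum_f_R0_ge0; intros; apply H; lia.
    + apply Rplus_lt_le_0_compat; [|apply H; lia].
      apply IH; [lia | intros; apply H; lia | exact Hp].
Qed.

Lemma sum_f_R0_split_at (f g : nat -> R) (n l : nat) :
  (l <= n)%nat -> g l = 0 -> (forall i, i <> l -> g i = f i) ->
  sum_f_R0 f n = sum_f_R0 g n + f l.
Proof.
  intros Hl H0 H; induction n as [|n IH]; simpl.
  - replace l with 0%nat in * by lia; lra.
  - destruct (Nat.eq_dec l (S n)) as [->|Hne].
    + rewrite H0, (sum_eq f g n); [lra|].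
      intros i Hi; symmetry; apply H; lia.
    + rewrite IH, (H (S n)) by lia; lra.
Qed.

(** Positivity is asked only in the open interval because the derivatives used below, of the form
    [(t - e) * kappa t], vanish at the end [t = e]. *)
Lemma is_derive_lt (g dg : R -> R) (x y : R) :
  x < y -> (forall t, x <= t <= y -> is_derive g t (dg t)) ->
  (forall t, x < t < y -> 0 < dg t) -> g x < g y.
Proof.
  intros Hxy Hd Hp.
  destruct (MVT_cor2 g dg x y Hxy) as [c [Hc Hcc]].
  - intros c Hc; apply is_derive_Reals; now apply Hd.
  - assert (H := Rmult_lt_0_compat (dg c) (y - x) (Hp c Hcc) ltac:(lra)); lra.
Qed.

(** * Summation by parts along the wall *)

Definition weight (n : nat) (beta : nat -> R) (i : nat) : R :=
  / 2 * (bext n beta (S i) - bext n beta i).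

Lemma clamp_left (a b t : R) : a <= b -> t <= a -> clamp a b t = a.
Proof. intros; unfold clamp; rewrite Rmin_right, Rmax_left; lra. Qed.

Lemma clamp_right (a b t : R) : a <= b -> b <= t -> clamp a b t = b.
Proof. intros; unfold clamp; rewrite Rmin_left, Rmax_right; lra. Qed.

Lemma clamp_mid (a b t : R) : a <= t <= b -> clamp a b t = t.
Proof. intros; unfold clamp; rewrite Rmin_right, Rmax_right; lra. Qed.

Lemma bext_mid (n : nat) (beta : nat -> R) (i : nat) :
  (1 <= i <= n)%nat -> bext n beta i = beta i.
Proof.
  intros H; unfold bext.
  rewrite (proj2 (Nat.eqb_neq i 0)), (proj2 (Nat.eqb_neq i (S n))); auto; lia.
Qed.

Lemma bext_0 (n : nat) (beta : nat -> R) : bext n beta 0 = -1.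
Proof. reflexivity. Qed.

Lemma bext_last (n : nat) (beta : nat -> R) : bext n beta (S n) = 1.
Proof. unfold bext; simpl; now rewrite Nat.eqb_refl. Qed.

(** Abel summation. The last slope stays free so that the induction can pass through it; the
    boundary term disappears once that slope is 1. *)
Lemma sum_by_parts (b g : nat -> R) (m : nat) :
  b 0%nat = -1 ->
  sum_f_R0 (fun i => / 2 * (b (S i) - b i) * g i) (S m) - g 0%nat =
  sum_f_R0 (fun k => / 2 * (1 - b (S k)) * (g (S k) - g k)) m
  - / 2 * (1 - b (S (S m))) * g (S m).
Proof.
  intros H0; induction m as [|m IH].
  - simpl; rewrite H0; field.
  - rewrite (tech5 _ (S m)), (tech5 (fun k => / 2 * (1 - b (S k)) * (g (S k) - g k)) m).
    transitivity (sum_f_R0 (fun i => / 2 * (b (S i) - b i) * g i) (S m) - g 0%nat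
      + / 2 * (b (S (S (S m))) - b (S (S m))) * g (S (S m))); [ring|].
    rewrite IH; field.
Qed.

(** The second conjunct is carried through the induction because clamping to the union of the first
    segments needs its ends in order. *)
Lemma clamp_telescope (x : nat -> R) (G : R -> R) (e : R) (m : nat) :
  (forall i, (i <= m)%nat -> x i < x (S i)) -> x 0%nat <= e ->
  sum_f_R0 (fun k => G (clamp (x k) (x (S k)) e) - G (x k)) m =
  G (clamp (x 0%nat) (x (S m)) e) - G (x 0%nat) /\ x 0%nat < x (S m).
Proof.
  intros Hx He; induction m as [|m IH]; simpl.
  - split; [reflexivity | apply Hx; lia].
  - destruct IH as [IH Hlt]; [intros; apply Hx; lia|].
    assert (Hs := Hx (S m) ltac:(lia)).
    split; [|lra].
    rewrite IH.
    destruct (Rle_dec e (x (S m))) as [H|H].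
    + rewrite (clamp_left (x (S m))), !(clamp_mid (x 0%nat)) by lra; ring.
    + rewrite (clamp_right (x 0%nat) (x (S m))) by lra.
      replace (clamp (x 0%nat) (x (S (S m))) e)
        with (clamp (x (S m)) (x (S (S m))) e); [ring|].
      destruct (Rle_dec e (x (S (S m)))).
      * now rewrite 2!clamp_mid by lra.
      * now rewrite 2!clamp_right by lra.
Qed.

(** The telescoping sum of [g c - g (x k)], which is [g e - g (x 0)], is subtracted from the
    summation by parts. The resulting coefficients are those of [chi_of], so this identity serves
    both the inequality below and, with [g = lg z], the evaluation of chi. *)
Lemma weighted_sum_clamp (n : nat) (beta x : nat -> R) (g : R -> R) (e : R) :
  (1 <= n)%nat -> (forall i, (i < n)%nat -> x i < x (S i)) ->
  x 0%nat <= e <= x n ->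
  sum_f_R0 (fun i => weight n beta i * g (x i)) n - g e =
  sum_f_R0 (fun k =>
      let c := clamp (x k) (x (S k)) e in
      - / 2 * (1 + beta (S k)) * (g c - g (x k))
      + / 2 * (1 - beta (S k)) * (g (x (S k)) - g c)) (n - 1).
Proof.
  intros Hn Hx He; destruct n as [|m]; [lia|].
  replace (S m - 1)%nat with m by lia.
  destruct (clamp_telescope x g e m) as [Ht _];
    [intros; apply Hx; lia | lra |].
  rewrite (clamp_mid (x 0%nat)) in Ht by lra.
  assert (Hp := sum_by_parts (bext (S m) beta) (fun i => g (x i)) m
                  (bext_0 _ _)).
  rewrite bext_last in Hp.
  transitivity (sum_f_R0 (fun k => / 2 * (1 - bext (S m) beta (S k))
                                   * (g (x (S k)) - g (x k))) m
    - sum_f_R0 (fun k => g (clamp (x k) (x (S k)) e) - g (x k)) m).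
  - rewrite Ht; unfold weight; simpl in *; lra.
  - rewrite <- minus_sum; apply sum_eq; intros i Hi.
    rewrite bext_mid by lia; cbv zeta; field.
Qed.

(** * Derivatives of logarithmic potentials and power sums *)

Lemma is_derive_ln_Rabs (t : R) : t <> 0 -> is_derive (fun y => ln (Rabs y)) t (/ t).
Proof.
  intros Ht.
  apply is_derive_ext with (fun y => / 2 * ln (y * y)).
  - intros y; change (/ 2 * ln (y * y) = ln (Rabs y)).
    destruct (Req_dec y 0) as [->|Hy].
    + rewrite Rabs_R0, Rmult_0_l.
      (* [is_derive_ext] asks for equality everywhere; at [y = 0] it holds because [ln] takes the
         value 0 at non-positive arguments. *)
      assert (ln 0 = 0) by (unfold ln; destruct (Rlt_dec 0 0); [exfalso; lra | reflexivity]).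
      lra.
    + replace (y * y) with (Rabs y * Rabs y) by (rewrite <- Rabs_mult; apply Rabs_right; nra).
      rewrite ln_mult by now apply Rabs_pos_lt.
      field.
  - auto_derive; [nra | field; auto].
Qed.

Lemma inv_pow4_pos (z t : R) : t <> z -> 0 < (/ (z - t)) ^ 4.
Proof.
  intros H; replace ((/ (z - t)) ^ 4) with (((/ (z - t)) ^ 2) ^ 2) by ring.
  apply pow2_gt_0, pow_nonzero, Rinv_neq_0_compat; lra.
Qed.

Lemma is_derive_ln_Rabs_sub (z t : R) :
  t <> z -> is_derive (fun y => ln (Rabs (z - y))) t (- / (z - t)).
Proof.
  intros H.
  assert (Hd := is_derive_comp (fun y => ln (Rabs y)) (fun y => z - y) t
    (/ (z - t)) (- 1) (is_derive_ln_Rabs (z - t) ltac:(lra))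
    ltac:(auto_derive; auto; ring)).
  replace (- / (z - t)) with (scal (- 1) (/ (z - t))); [exact Hd|].
  unfold scal; simpl; unfold mult; simpl; ring.
Qed.

(** With the weights [weight n beta], [powsum 1] is T and [powsum 2] is -T'. *)
Definition powsum (n : nat) (w a : nat -> R) (p : nat) (z : R) : R :=
  sum_f_R0 (fun i => w i * (/ (z - a i)) ^ p) n.

Definition logsum (n : nat) (w a : nat -> R) (z : R) : R :=
  sum_f_R0 (fun i => w i * ln (Rabs (z - a i))) n.

(** A pole of weight 0 is allowed, so that sums from which one term has been dropped count as
    regular at its pole. *)
Definition regular_at (n : nat) (w a : nat -> R) (z : R) : Prop :=
  forall i, (i <= n)%nat -> w i = 0 \/ z <> a i.

Lemma is_derive_powsum (n : nat) (w a : nat -> R) (p : nat) (z : R) :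
  regular_at n w a z ->
  is_derive (powsum n w a p) z (- INR p * powsum n w a (S p) z).
Proof.
  intros H; unfold powsum; rewrite scal_sum.
  apply (is_derive_sum_f_R0 (fun i z => w i * (/ (z - a i)) ^ p)); intros k Hk.
  destruct (H k Hk) as [->|Hz].
  - apply is_derive_ext with (fun _ => 0); [intros; symmetry; apply Rmult_0_l|].
    replace (0 * _ * _) with 0 by ring; apply @is_derive_const.
  - auto_derive; [lra|].
    destruct p as [|p]; [simpl; field; lra|].
    rewrite Nat.pred_succ; cbn [pow]; unfold Rminus; field; lra.
Qed.

Lemma is_derive_logsum (n : nat) (w a : nat -> R) (z : R) :
  regular_at n w a z -> is_derive (logsum n w a) z (powsum n w a 1 z).
Proof.
  intros H; unfold logsum, powsum.
  apply (is_derive_sum_f_R0 (fun i z => w i * ln (Rabs (z - a i)))); intros k Hk.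
  destruct (H k Hk) as [->|Hz].
  - apply is_derive_ext with (fun _ => 0); [intros; symmetry; apply Rmult_0_l|].
    replace (0 * _) with 0 by ring; apply @is_derive_const.
  - apply is_derive_scal.
    assert (Hd := is_derive_comp (fun y => ln (Rabs y)) (fun y => y - a k) z
      (/ (z - a k)) 1 (is_derive_ln_Rabs (z - a k) ltac:(lra)) ltac:(auto_derive; auto; ring)).
    replace ((/ (z - a k)) ^ 1) with (scal 1 (/ (z - a k))); [exact Hd|].
    unfold scal; simpl; unfold mult; simpl; ring.
Qed.

(* With [P = (s z + d) exp (logsum z)] one has [P'' = exp (logsum z) * inflection z]. *)
Definition inflection (n : nat) (w a : nat -> R) (s d z : R) : R :=
  2 * s * powsum n w a 1 z
  + (s * z + d) * (powsum n w a 1 z ^ 2 - powsum n w a 2 z).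

(** This is P'''. Its sign is that of the bracket, which therefore decides the monotonicity of
    P''. *)
Lemma is_derive_exp_inflection (n : nat) (w a : nat -> R) (s d z : R) :
  regular_at n w a z ->
  is_derive (fun y => exp (logsum n w a y) * inflection n w a s d y) z
    (exp (logsum n w a z) *
      (3 * s * (powsum n w a 1 z ^ 2 - powsum n w a 2 z)
       + (s * z + d) * (powsum n w a 1 z ^ 3
          - 3 * powsum n w a 1 z * powsum n w a 2 z + 2 * powsum n w a 3 z))).
Proof.
  intros H.
  assert (HL := is_derive_logsum n w a z H).
  assert (H1 := is_derive_powsum n w a 1 z H).
  assert (H2 := is_derive_powsum n w a 2 z H).
  unfold inflection; simpl INR in *.
  auto_derive.
  - repeat split; eexists; eassumption.
  - replace (Derive _ z) with (powsum n w a 1 z)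
      by (symmetry; apply is_derive_unique, HL).
    replace (Derive (fun x : R => powsum n w a 1 x) z) with (- 1 * powsum n w a 2 z)
      by (symmetry; apply is_derive_unique, H1).
    replace (Derive (fun x : R => powsum n w a 2 x) z) with (- (1 + 1) * powsum n w a 3 z)
      by (symmetry; apply is_derive_unique, H2).
    ring.
Qed.

(** * The weighted inequality along the wall *)

Section Backwall.

Context (n : nat) (x beta : nat -> R).
Context (Hn : (1 <= n)%nat)
        (Hx : forall i, (i < n)%nat -> x i < x (S i))
        (Hb : forall i, (1 <= i <= n)%nat -> -1 <= beta i <= 1)
        (Hne : forall i, (i <= n)%nat -> bext n beta i <> bext n beta (S i)).

Lemma beta_first : -1 < beta 1%nat.
Proof.
  assert (H := Hne 0%nat ltac:(lia)).
  rewrite bext_0, bext_mid in H by lia.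
  assert (H1 := Hb 1%nat ltac:(lia)); lra.
Qed.

Lemma beta_last : beta n < 1.
Proof.
  assert (H := Hne n ltac:(lia)).
  rewrite bext_last, bext_mid in H by lia.
  assert (H1 := Hb n ltac:(lia)); lra.
Qed.

Lemma x_lt (i j : nat) : (i < j <= n)%nat -> x i < x j.
Proof.
  intros [Hij Hj]; induction j as [|j IH]; [lia|].
  destruct (Nat.eq_dec i j) as [->|]; [apply Hx; lia|].
  assert (H := Hx j ltac:(lia)); assert (H1 := IH ltac:(lia) ltac:(lia)); lra.
Qed.

Lemma x_le (i j : nat) : (i <= j <= n)%nat -> x i <= x j.
Proof.
  intros H; destruct (Nat.eq_dec i j) as [->|]; [lra|].
  assert (H1 := x_lt i j ltac:(lia)); lra.
Qed.

Lemma weighted_sum_gt (g : R -> R) (e : R) :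
  x 0%nat <= e <= x n ->
  (forall k, (k < n)%nat -> beta (S k) <> -1 ->
     x k < clamp (x k) (x (S k)) e -> g (clamp (x k) (x (S k)) e) < g (x k)) ->
  (forall k, (k < n)%nat -> beta (S k) <> 1 ->
     clamp (x k) (x (S k)) e < x (S k) ->
     g (clamp (x k) (x (S k)) e) < g (x (S k))) ->
  g e < sum_f_R0 (fun i => weight n beta i * g (x i)) n.
Proof.
  intros He Hl Hr.
  apply Rlt_0_minus; rewrite weighted_sum_clamp by auto; cbv zeta.
  assert (Hc : forall k, (k < n)%nat ->
    x k <= clamp (x k) (x (S k)) e <= x (S k)).
  { intros k Hk; assert (H := Hx k Hk); unfold clamp.
    split; [apply Rmax_l | apply Rmax_lub; [lra | apply Rmin_l]]. }
  assert (Hnn : forall k, (k < n)%nat ->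
    0 <= - / 2 * (1 + beta (S k)) * (g (clamp (x k) (x (S k)) e) - g (x k)) /\
    0 <= / 2 * (1 - beta (S k)) * (g (x (S k)) - g (clamp (x k) (x (S k)) e))).
  { intros k Hk; specialize (Hl k Hk); specialize (Hr k Hk); specialize (Hc k Hk).
    assert (Hbk := Hb (S k) ltac:(lia)); split.
    - destruct (Req_dec (beta (S k)) (-1)) as [->|H1]; [lra|].
      destruct (Req_dec (clamp (x k) (x (S k)) e) (x k)) as [->|H2]; [lra|].
      specialize (Hl H1 ltac:(lra)); nra.
    - destruct (Req_dec (beta (S k)) 1) as [->|H1]; [lra|].
      destruct (Req_dec (clamp (x k) (x (S k)) e) (x (S k))) as [->|H2]; [lra|].
      specialize (Hr H1 ltac:(lra)); nra. }
  assert (H0n := x_lt 0 n ltac:(lia)).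
  (* Strictness comes from one segment. If [x 0 < e], part of the first segment lies below [e] and
     carries [1 + beta 1 > 0]; if [e = x 0], the whole last segment lies above [e] and carries
     [1 - beta n > 0]. *)
  destruct (Rlt_dec (x 0%nat) e) as [H|H].
  - apply sum_f_R0_gt0 with 0%nat; [lia | |].
    + intros k Hk; destruct (Hnn k ltac:(lia)); lra.
    + destruct (Hnn 0%nat ltac:(lia)) as [_ H2].
      assert (H1 : x 0%nat < clamp (x 0%nat) (x 1%nat) e).
      { assert (H3 := Hx 0%nat ltac:(lia)); unfold clamp.
        eapply Rlt_le_trans; [|apply Rmax_r]; apply Rmin_glb_lt; lra. }
      assert (H3 := beta_first).
      specialize (Hl 0%nat ltac:(lia) ltac:(lra) H1); nra.
  - apply sum_f_R0_gt0 with (n - 1)%nat; [lia | |].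
    + intros k Hk; destruct (Hnn k ltac:(lia)); lra.
    + destruct (Hnn (n - 1)%nat ltac:(lia)) as [H2 _].
      specialize (Hr (n - 1)%nat ltac:(lia)).
      replace (S (n - 1)) with n in * by lia.
      assert (H4 := Hx (n - 1)%nat ltac:(lia)).
      replace (S (n - 1)) with n in * by lia.
      assert (H5 := x_le 0 (n - 1) ltac:(lia)).
      assert (H3 := beta_last).
      rewrite clamp_left in * by lra.
      specialize (Hr ltac:(lra) H4); nra.
Qed.

(* [e] stands for e^tau: the segments that carry a non-zero weight in
   [weighted_sum_clamp], cut at [e], avoid [z]. *)
Definition admissible (z e : R) : Prop :=
  x 0%nat < e < x n /\
  forall k, (k < n)%nat ->
    (beta (S k) <> -1 -> x k < clamp (x k) (x (S k)) e ->
       ~ (x k <= z <= clamp (x k) (x (S k)) e)) /\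
    (beta (S k) <> 1 -> clamp (x k) (x (S k)) e < x (S k) ->
       ~ (clamp (x k) (x (S k)) e <= z <= x (S k))).

(** The factor [t - e] times a positive [kappa] encodes a function that falls before [e] and rises
    after it. Two exceptional points serve the comparison of two parameters with a common E; for a
    single parameter they coincide. *)
Lemma weighted_sum_gt_derive (g kappa : R -> R) (z1 z2 e : R) :
  admissible z1 e -> admissible z2 e ->
  (forall t, x 0%nat <= t <= x n -> t <> z1 -> t <> z2 ->
     is_derive g t ((t - e) * kappa t) /\ 0 < kappa t) ->
  g e < sum_f_R0 (fun i => weight n beta i * g (x i)) n.
Proof.
  intros [He A1] [_ A2] Hg.
  assert (Hr : forall k, (k < n)%nat -> x 0%nat <= x k /\ x (S k) <= x n)
    by (intros; split; apply x_le; lia).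
  apply weighted_sum_gt; [lra | |]; intros k Hk Hbk Hc;
    specialize (Hr k Hk); assert (Hxk := Hx k Hk).
  - destruct (A1 k Hk) as [B1 _]; destruct (A2 k Hk) as [B2 _].
    specialize (B1 Hbk Hc); specialize (B2 Hbk Hc).
    assert (Hm : clamp (x k) (x (S k)) e <= e /\ clamp (x k) (x (S k)) e <= x (S k)).
    { revert Hc; unfold clamp, Rmax, Rmin; repeat destruct Rle_dec; lra. }
    apply Ropp_lt_cancel.
    apply (is_derive_lt (fun t => - g t) (fun t => - ((t - e) * kappa t)) _ _ Hc).
    + intros t Ht; apply (is_derive_opp g); apply Hg; lra.
    + intros t Ht; destruct (Hg t) as [_ Hp]; try lra; nra.
  - destruct (A1 k Hk) as [_ B1]; destruct (A2 k Hk) as [_ B2].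
    specialize (B1 Hbk Hc); specialize (B2 Hbk Hc).
    assert (Hm : e <= clamp (x k) (x (S k)) e /\ x k <= clamp (x k) (x (S k)) e).
    { revert Hc; unfold clamp, Rmax, Rmin; repeat destruct Rle_dec; lra. }
    apply (is_derive_lt g (fun t => (t - e) * kappa t) _ _ Hc).
    + intros t Ht; apply Hg; lra.
    + intros t Ht; destruct (Hg t) as [_ Hp]; try lra; nra.
Qed.

(** * Location of E = z - 1/T *)

Local Notation W := (weight n beta).
Local Notation T := (powsum n W x 1).

(** The condition suited to a cut at [x n], where only the coefficients [1 + beta] remain;
    [right_clear] is suited to a cut at [x 0], where only [1 - beta] remain. *)
Definition left_clear (z : R) : Prop :=
  forall k, (k < n)%nat -> beta (S k) <> -1 -> ~ (x k <= z <= x (S k)).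

Definition right_clear (z : R) : Prop :=
  forall k, (k < n)%nat -> beta (S k) <> 1 -> ~ (x k <= z <= x (S k)).

Lemma Rinv_sub_lt (z s t : R) :
  s < t -> ~ (s <= z <= t) -> / (z - s) < / (z - t).
Proof.
  intros Hst Hz; destruct (Rlt_dec z s).
  - replace (z - s) with (- (s - z)) by ring; replace (z - t) with (- (t - z)) by ring.
    rewrite !Rinv_opp; apply Ropp_lt_contravar, Rinv_lt_contravar; nra.
  - apply Rinv_lt_contravar; nra.
Qed.

Lemma powsum1_eq (z : R) : T z = sum_f_R0 (fun i => W i * / (z - x i)) n.
Proof. unfold powsum; apply sum_eq; intros; ring. Qed.

(** The weighted inequality with the cut at [x n], for the decreasing function [- / (z - t)]. The
    companion [powsum1_gt] cuts at [x 0] and takes the increasing [/ (z - t)]. *)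
Lemma powsum1_lt (z : R) : left_clear z -> T z < / (z - x n).
Proof.
  intros Hl; rewrite powsum1_eq; apply Ropp_lt_cancel.
  assert (H0n := x_lt 0 n ltac:(lia)).
  apply Rlt_le_trans with
    (sum_f_R0 (fun i => W i * (fun t => - / (z - t)) (x i)) n).
  - apply (weighted_sum_gt (fun t => - / (z - t))); [lra | |]; intros k Hk Hbk Hc;
      rewrite clamp_right in * by (try (apply Rlt_le, Hx; lia); apply x_le; lia);
      [|lra].
    apply Ropp_lt_contravar, Rinv_sub_lt; [lra | now apply Hl].
  - apply Req_le; replace (- sum_f_R0 _ n)
      with (-1 * sum_f_R0 (fun i => W i * / (z - x i)) n) by ring.
    rewrite scal_sum; apply sum_eq; intros; ring.
Qed.

Lemma powsum1_gt (z : R) : right_clear z -> / (z - x 0%nat) < T z.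
Proof.
  intros Hl; rewrite powsum1_eq.
  assert (H0n := x_lt 0 n ltac:(lia)).
  apply (weighted_sum_gt (fun t => / (z - t))); [lra | |]; intros k Hk Hbk Hc;
    rewrite clamp_left in * by (try (apply Rlt_le, Hx; lia); apply x_le; lia);
    [lra|].
  apply Rinv_sub_lt; [lra | now apply Hl].
Qed.

Lemma segment_unique (z : R) (j k : nat) :
  (j < n)%nat -> (k < n)%nat -> x j < z < x (S j) -> x k <= z <= x (S k) -> j = k.
Proof.
  intros Hj Hk H1 H2; destruct (Nat.lt_trichotomy j k) as [H|[H|H]]; [|exact H|].
  - assert (H3 := x_le (S j) k ltac:(lia)); lra.
  - assert (H3 := x_le (S k) j ltac:(lia)); lra.
Qed.

Lemma outside_clear (z : R) :
  z < x 0%nat \/ x n < z -> left_clear z /\ right_clear z.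
Proof.
  intros Hz; split; intros k Hk _ H;
    assert (H1 := x_le 0 k ltac:(lia)); assert (H2 := x_le (S k) n ltac:(lia)); lra.
Qed.

Lemma descending_clear (z : R) (j : nat) :
  (j < n)%nat -> beta (S j) = -1 -> x j < z < x (S j) -> left_clear z.
Proof.
  intros Hj Hbj Hz k Hk Hbk H.
  now rewrite (segment_unique z j k) in Hbj.
Qed.

Lemma ascending_clear (z : R) (j : nat) :
  (j < n)%nat -> beta (S j) = 1 -> x j < z < x (S j) -> right_clear z.
Proof.
  intros Hj Hbj Hz k Hk Hbk H.
  now rewrite (segment_unique z j k) in Hbj.
Qed.

Lemma segment_not_breakpoint (z : R) (j i : nat) :
  (j < n)%nat -> x j < z < x (S j) -> (i <= n)%nat -> z <> x i.
Proof.
  intros Hj Hz Hi ->; destruct (Nat.le_gt_cases i j).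
  - assert (H1 := x_le i j ltac:(lia)); lra.
  - assert (H1 := x_le (S j) i ltac:(lia)); lra.
Qed.

(** Only the upper bound of T is available on a segment of slope -1, but it suffices:
    [T z < / (z - x n) < 0] gives the sign of T and, after inversion, both bounds on E. *)
Lemma descending_location (z : R) (j : nat) :
  (j < n)%nat -> beta (S j) = -1 -> x j < z < x (S j) ->
  T z < 0 /\ z < z - / T z < x n.
Proof.
  intros Hj Hbj Hz.
  assert (H := powsum1_lt z (descending_clear z j Hj Hbj Hz)).
  assert (H1 := x_le (S j) n ltac:(lia)).
  assert (H2 := Rinv_lt_0_compat (z - x n) ltac:(lra)).
  assert (H3 := Rinv_lt_0_compat (T z) ltac:(lra)).
  repeat split; try lra.
  assert (H4 : / / (z - x n) < / T z) by (apply Rinv_lt_contravar; nra).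
  rewrite Rinv_inv in H4; lra.
Qed.

Lemma ascending_location (z : R) (j : nat) :
  (j < n)%nat -> beta (S j) = 1 -> x j < z < x (S j) ->
  0 < T z /\ x 0%nat < z - / T z < z.
Proof.
  intros Hj Hbj Hz.
  assert (H := powsum1_gt z (ascending_clear z j Hj Hbj Hz)).
  assert (H1 := x_le 0 j ltac:(lia)).
  assert (H2 := Rinv_0_lt_compat (z - x 0%nat) ltac:(lra)).
  assert (H3 := Rinv_0_lt_compat (T z) ltac:(lra)).
  repeat split; try lra.
  assert (H4 : / T z < / / (z - x 0%nat)) by (apply Rinv_lt_contravar; nra).
  rewrite Rinv_inv in H4; lra.
Qed.

Lemma outside_location (z : R) :
  z < x 0%nat \/ x n < z -> T z <> 0 /\ x 0%nat < z - / T z < x n.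
Proof.
  intros Hz; destruct (outside_clear z Hz) as [Hl Hr].
  assert (H1 := powsum1_lt z Hl); assert (H2 := powsum1_gt z Hr).
  assert (H0n := x_lt 0 n ltac:(lia)).
  assert (H : T z <> 0 /\ / / (z - x n) < / T z < / / (z - x 0%nat)).
  { destruct Hz as [Hz|Hz].
    - assert (H3 := Rinv_lt_0_compat (z - x 0%nat) ltac:(lra)).
      assert (H4 := Rinv_lt_0_compat (z - x n) ltac:(lra)).
      split; [lra | split; apply Rinv_lt_contravar; nra].
    - assert (H3 := Rinv_0_lt_compat (z - x 0%nat) ltac:(lra)).
      assert (H4 := Rinv_0_lt_compat (z - x n) ltac:(lra)).
      split; [lra | split; apply Rinv_lt_contravar; nra]. }
  rewrite !Rinv_inv in H; split; [tauto | lra].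
Qed.

(** * Admissible parameters and the inequalities that hold at them *)

Definition frozen (z : R) : Prop :=
  z < x 0%nat \/ x n < z \/
  exists j, (j < n)%nat /\ (beta (S j) = 1 \/ beta (S j) = -1) /\ x j < z < x (S j).

(** Outside the wall no segment contains [z]. On a segment of slope 1 one has E < z, so the piece
    below E misses [z], while the piece above E carries [1 - beta = 0]. Slope -1 is the mirror
    image. *)
Lemma frozen_admissible (z : R) :
  frozen z ->
  (forall i, (i <= n)%nat -> z <> x i) /\ T z <> 0 /\ admissible z (z - / T z).
Proof.
  intros Hz.
  assert (Hout : z < x 0%nat \/ x n < z ->
    (forall i, (i <= n)%nat -> z <> x i) /\ T z <> 0 /\ admissible z (z - / T z)).
  { intros H; destruct (outside_location z H) as [HT HE].
    destruct (outside_clear z H) as [Hl Hr].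
    split; [|split; [exact HT | split; [exact HE|]]].
    - intros i Hi ->; assert (H1 := x_le 0 i ltac:(lia));
        assert (H2 := x_le i n ltac:(lia)); lra.
    - intros k Hk; assert (Hk1 := Hx k Hk).
      assert (H1 : x k <= clamp (x k) (x (S k)) (z - / T z) <= x (S k))
        by (unfold clamp; split; [apply Rmax_l |
              apply Rmax_lub; [lra | apply Rmin_l]]).
      split; intros Hbk _ H2; [apply (Hl k Hk Hbk) | apply (Hr k Hk Hbk)]; lra. }
  destruct Hz as [Hz|[Hz|[j [Hj [Hbj Hz]]]]]; [now apply Hout; left | now apply Hout; right|].
  split; [intros i Hi; now apply segment_not_breakpoint with j|].
  assert (H0 := x_le 0 j ltac:(lia)); assert (H0' := x_le (S j) n ltac:(lia)).
  destruct Hbj as [Hbj|Hbj].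
  - destruct (ascending_location z j Hj Hbj Hz) as [HT HE].
    split; [lra | split; [lra|]].
    intros k Hk; assert (Hk1 := Hx k Hk).
    assert (H1 : x k <= clamp (x k) (x (S k)) (z - / T z) <= x (S k))
      by (unfold clamp; split; [apply Rmax_l |
            apply Rmax_lub; [lra | apply Rmin_l]]).
    split; intros Hbk Hc H2; assert (k = j)
      by (symmetry; apply segment_unique with z; auto; lra); subst k.
    + revert H2 Hc; unfold clamp, Rmax, Rmin; repeat destruct Rle_dec; lra.
    + contradiction.
  - destruct (descending_location z j Hj Hbj Hz) as [HT HE].
    split; [lra | split; [lra|]].
    intros k Hk; assert (Hk1 := Hx k Hk).
    assert (H1 : x k <= clamp (x k) (x (S k)) (z - / T z) <= x (S k))
      by (unfold clamp; split; [apply Rmax_l |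
            apply Rmax_lub; [lra | apply Rmin_l]]).
    split; intros Hbk Hc H2; assert (k = j)
      by (symmetry; apply segment_unique with z; auto; lra); subst k.
    + contradiction.
    + revert H2 Hc; unfold clamp, Rmax, Rmin; repeat destruct Rle_dec; lra.
Qed.

(** Here E = z. The segment ending at [x l] has slope -1 and lies below the cut, where its
    coefficient [1 + beta] is 0; the one starting there has slope 1 and lies above, where [1 - beta]
    is 0. *)
Lemma join_admissible (l : nat) :
  (1 <= l <= n - 1)%nat -> beta l = -1 -> beta (S l) = 1 -> admissible (x l) (x l).
Proof.
  intros Hl Hb1 Hb2; split; [split; apply x_lt; lia|].
  intros k Hk; destruct (Nat.lt_trichotomy (S k) l) as [H|[H|H]].
  - assert (H1 := x_lt (S k) l ltac:(lia)); assert (H2 := Hx k Hk).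
    rewrite clamp_right by lra; split; intros; lra.
  - rewrite H; assert (H2 := Hx k Hk); rewrite H in H2.
    rewrite clamp_right by lra; split; intros; lra.
  - destruct (Nat.eq_dec k l) as [->|Hkl].
    + assert (H2 := Hx l Hk); rewrite clamp_left by lra; split; intros; lra.
    + assert (H1 := x_lt l k ltac:(lia)); assert (H2 := Hx k Hk).
      rewrite clamp_left by lra; split; intros; lra.
Qed.

(* [weighted_sum_gt_derive] for [g t = c1 u + c2 u^2 + c3 u^3] with [u = / (z - t)]. *)
Lemma cubic_powsum_gt (z e c1 c2 c3 : R) (kappa : R -> R) :
  admissible z e ->
  (forall t, x 0%nat <= t <= x n -> t <> z ->
     c1 * (/ (z - t)) ^ 2 + 2 * c2 * (/ (z - t)) ^ 3 + 3 * c3 * (/ (z - t)) ^ 4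
       = (t - e) * kappa t /\ 0 < kappa t) ->
  c1 * / (z - e) + c2 * (/ (z - e)) ^ 2 + c3 * (/ (z - e)) ^ 3 <
  c1 * T z + c2 * powsum n W x 2 z + c3 * powsum n W x 3 z.
Proof.
  intros Ha Hk.
  assert (H := weighted_sum_gt_derive
    (fun t => c1 * / (z - t) + c2 * (/ (z - t)) ^ 2 + c3 * (/ (z - t)) ^ 3)
    kappa z z e Ha Ha).
  eapply Rlt_le_trans; [apply H|].
  - intros t Ht Hz _; destruct (Hk t Ht Hz) as [H1 H2]; split; [|exact H2].
    rewrite <- H1; auto_derive; [lra | simpl; unfold Rminus; field; lra].
  - apply Req_le; unfold powsum; rewrite !scal_sum, <- !plus_sum.
    apply sum_eq; intros; ring.
Qed.

(** With [u = / (z - t)], the function [g = - u^2 / 2 + u^3 / (3 T)] has derivative [(t - E) u^4].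
    At [t = E] one has [u = T], so [g] equals [- T^2 / 6] there, and six times the weighted
    inequality is the claim. *)
Lemma third_order_frozen (z : R) :
  frozen z ->
  0 < (T z ^ 3 - 3 * T z * powsum n W x 2 z + 2 * powsum n W x 3 z) / T z.
Proof.
  intros Hz; destruct (frozen_admissible z Hz) as [_ [HT Ha]].
  assert (H := cubic_powsum_gt z _ 0 (- / 2) (/ (3 * T z))
                 (fun t => (/ (z - t)) ^ 4) Ha).
  replace (z - (z - / T z)) with (/ T z) in H by ring; rewrite Rinv_inv in H.
  lapply H; clear H; [intros H|].
  - apply Rmult_lt_reg_l with (/ 6); [lra|]; rewrite Rmult_0_r.
    eapply Rlt_le_trans; [apply (proj2 (Rlt_0_minus _ _) H)|].
    apply Req_le; field; exact HT.
  - intros t _ Ht; split; [field; split; (exact HT || lra) | now apply inv_pow4_pos].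
Qed.

(* At [z = x l] the term [i = l] of [powsum] is [W l * (/ 0)^2 = 0]. *)
Lemma join_second_order (l : nat) :
  (1 <= l <= n - 1)%nat -> beta l = -1 -> beta (S l) = 1 ->
  powsum n W x 2 (x l) < 0.
Proof.
  intros Hl H1 H2.
  assert (H := cubic_powsum_gt (x l) (x l) 0 (- / 2) 0
    (fun t => (/ (x l - t)) ^ 4) (join_admissible l Hl H1 H2)).
  rewrite Rminus_diag, Rinv_0 in H.
  lapply H; clear H; [lra|].
  intros t _ Ht; split; [field; lra | now apply inv_pow4_pos].
Qed.

(** For [g = u - u^2 / (2 T)] with [u = / (z - t)] the derivative is [- (t - E) u^3], of one sign
    pattern because [z - t] keeps its sign along the wall. If [T^2] equalled [powsum 2], the
    weighted sum and [g E] would both be [T / 2]. For [z] to the right of the wall [g] is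
    negated. *)
Lemma outside_no_inflection (z : R) :
  z < x 0%nat \/ x n < z -> T z ^ 2 - powsum n W x 2 z <> 0.
Proof.
  intros Hz.
  destruct (frozen_admissible z ltac:(unfold frozen; tauto)) as [_ [HT Ha]].
  intros H0; assert (Hs : powsum n W x 2 z = T z ^ 2) by lra.
  destruct Hz as [Hz|Hz].
  - assert (H := cubic_powsum_gt z _ 1 (- / (2 * T z)) 0
                   (fun t => (/ (t - z)) ^ 3) Ha).
    replace (z - (z - / T z)) with (/ T z) in H by ring; rewrite Rinv_inv, Hs in H.
    lapply H; clear H; [lra|].
    intros t Ht Ht'; split; [field; repeat split; (exact HT || lra)|].
    apply pow_lt, Rinv_0_lt_compat; lra.
  - assert (H := cubic_powsum_gt z _ (-1) (/ (2 * T z)) 0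
                   (fun t => (/ (z - t)) ^ 3) Ha).
    replace (z - (z - / T z)) with (/ T z) in H by ring; rewrite Rinv_inv, Hs in H.
    lapply H; clear H; [lra|].
    intros t Ht Ht'; split; [field; repeat split; (exact HT || lra)|].
    apply pow_lt, Rinv_0_lt_compat; lra.
Qed.

Lemma Rinv_sqr_lt (s t : R) : 0 < s < t -> (/ t) ^ 2 < (/ s) ^ 2.
Proof.
  intros H; assert (H1 : / t < / s) by (apply Rinv_lt_contravar; nra).
  assert (H2 := Rinv_0_lt_compat t ltac:(lra)); nra.
Qed.

(** Both sums are compared with the pole at [x 0]: [powsum 2 < (/ (z - x 0))^2 < T^2]. The first
    segment has [1 - beta = 0], and on all later ones, which lie to the right of [z],
    [- (/ (z - t))^2] increases. *)
Lemma first_segment_no_inflection (z : R) :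
  beta 1%nat = 1 -> x 0%nat < z < x 1%nat -> T z ^ 2 - powsum n W x 2 z <> 0.
Proof.
  intros Hb1 Hz.
  assert (HT := powsum1_gt z (ascending_clear z 0 ltac:(lia) Hb1 Hz)).
  assert (Hp := Rinv_0_lt_compat (z - x 0%nat) ltac:(lra)).
  assert (H0n := x_lt 0 n ltac:(lia)).
  assert (H : - (/ (z - x 0%nat)) ^ 2 <
    sum_f_R0 (fun i => weight n beta i * - (/ (z - x i)) ^ 2) n).
  { apply (weighted_sum_gt (fun t => - (/ (z - t)) ^ 2)); [lra | |]; intros k Hk Hbk Hc;
      rewrite clamp_left in * by (try (apply Rlt_le, Hx; lia); apply x_le; lia);
      [lra|].
    assert (Hk0 : k <> 0%nat) by (intros ->; contradiction).
    assert (H1 := x_le 1 k ltac:(lia)).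
    apply Ropp_lt_contravar.
    replace (z - x k) with (- (x k - z)) by ring.
    replace (z - x (S k)) with (- (x (S k) - z)) by ring.
    rewrite !Rinv_opp, <- !Rsqr_pow2, <- !Rsqr_neg, !Rsqr_pow2.
    apply Rinv_sqr_lt; lra. }
  replace (sum_f_R0 _ n) with (- powsum n W x 2 z) in H.
  - nra.
  - unfold powsum; replace (- sum_f_R0 _ n)
      with (-1 * sum_f_R0 (fun i => W i * (/ (z - x i)) ^ 2) n) by ring.
    rewrite scal_sum; apply sum_eq; intros; ring.
Qed.

(** The mirror image, comparing with the pole at [x n]. *)
Lemma last_segment_no_inflection (z : R) :
  beta n = -1 -> x (n - 1)%nat < z < x n -> T z ^ 2 - powsum n W x 2 z <> 0.
Proof.
  intros Hb1 Hz; assert (HSn : S (n - 1) = n) by lia.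
  assert (HT := powsum1_lt z (descending_clear z (n - 1) ltac:(lia)
    ltac:(now rewrite HSn) ltac:(now rewrite HSn))).
  assert (Hp := Rinv_lt_0_compat (z - x n) ltac:(lra)).
  assert (H0n := x_lt 0 n ltac:(lia)).
  assert (H : - (/ (z - x n)) ^ 2 <
    sum_f_R0 (fun i => weight n beta i * - (/ (z - x i)) ^ 2) n).
  { apply (weighted_sum_gt (fun t => - (/ (z - t)) ^ 2)); [lra | |]; intros k Hk Hbk Hc;
      rewrite clamp_right in * by (try (apply Rlt_le, Hx; lia); apply x_le; lia);
      [|lra].
    assert (Hk0 : k <> (n - 1)%nat) by (intros ->; rewrite HSn in Hbk; contradiction).
    assert (H1 := x_le (S k) (n - 1) ltac:(lia)).
    apply Ropp_lt_contravar, Rinv_sqr_lt; lra. }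
  replace (sum_f_R0 _ n) with (- powsum n W x 2 z) in H.
  - nra.
  - unfold powsum; replace (- sum_f_R0 _ n)
      with (-1 * sum_f_R0 (fun i => W i * (/ (z - x i)) ^ 2) n) by ring.
    rewrite scal_sum; apply sum_eq; intros; ring.
Qed.

(* [g] is, by partial fractions, a primitive of
   [(t - e) / ((t - z1)^2 (t - z2)^2)]; the two tangency conditions and the equal
   logarithms say that its weighted sum equals [g e]. *)
Lemma tangency_unique (z1 z2 e : R) :
  admissible z1 e -> admissible z2 e ->
  (z1 = e \/ T z1 = / (z1 - e)) -> (z2 = e \/ T z2 = / (z2 - e)) ->
  logsum n W x z1 - ln (Rabs (z1 - e)) = logsum n W x z2 - ln (Rabs (z2 - e)) ->
  z1 = z2.
Proof.
  intros A1 A2 H1 H2 HL.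
  destruct (Req_dec z1 z2) as [|Hz]; [assumption|exfalso].
  set (D := z2 - z1); set (A := (z1 - e) / D ^ 2); set (C := (z2 - e) / D ^ 2).
  set (L1 := fun t => ln (Rabs (z1 - t))); set (L2 := fun t => ln (Rabs (z2 - t))).
  set (g := fun t => A * / (z1 - t) + C * / (z2 - t) - (A + C) / D * (L2 t - L1 t)).
  assert (HD : D <> 0) by (unfold D; lra).
  assert (H := weighted_sum_gt_derive g
    (fun t => (/ (z1 - t) * / (z2 - t)) ^ 2) z1 z2 e A1 A2).
  lapply H; clear H; [intros H|].
  - revert H.
    replace (sum_f_R0 _ n) with (A * T z1 + C * T z2
      - (A + C) / D * (logsum n W x z2 - logsum n W x z1)).
    + unfold g, L1, L2.
      replace (logsum n W x z2 - logsum n W x z1)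
        with (ln (Rabs (z2 - e)) - ln (Rabs (z1 - e))) by lra.
      replace (A * T z1) with (A * / (z1 - e)).
      (* If [z1 = e], then [A] is 0 and both sides vanish; otherwise the tangency condition
         applies. *)
      2: { destruct H1 as [-> | ->]; [|reflexivity]; unfold A.
           rewrite Rminus_diag; unfold Rdiv; ring. }
      replace (C * T z2) with (C * / (z2 - e)).
      2: { destruct H2 as [-> | ->]; [|reflexivity]; unfold C.
           rewrite Rminus_diag; unfold Rdiv; ring. }
      apply Rlt_irrefl.
    + transitivity (A * T z1 + C * T z2 + - ((A + C) / D) * logsum n W x z2
        + (A + C) / D * logsum n W x z1); [ring|].
      unfold powsum, logsum; rewrite !scal_sum, <- !plus_sum.
      apply sum_eq; intros; unfold g, L1, L2; ring.
  - intros t _ Ht1 Ht2; split.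
    + assert (D1 : is_derive L1 t (- / (z1 - t))).
      { now apply is_derive_ln_Rabs_sub. }
      assert (D2 : is_derive L2 t (- / (z2 - t))).
      { now apply is_derive_ln_Rabs_sub. }
      unfold g; auto_derive.
      * repeat split; try lra; eexists; eassumption.
      * replace (Derive (fun x : R => L1 x) t) with (- / (z1 - t))
          by (symmetry; apply is_derive_unique, D1).
        replace (Derive (fun x : R => L2 x) t) with (- / (z2 - t))
          by (symmetry; apply is_derive_unique, D2).
        unfold A, C, D; field; unfold D in HD; lra.
    + apply pow2_gt_0, Rmult_integral_contrapositive_currified;
        apply Rinv_neq_0_compat; lra.
Qed.

(** * A unique root of P'' on an interval *)

Lemma IVT_root (f : R -> R) (a b : R) :
  a < b -> (forall z, a <= z <= b -> ex_derive f z) -> f a < 0 -> 0 < f b ->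
  exists z, a <= z <= b /\ f z = 0.
Proof.
  intros Hab Hd Ha Hb'.
  destruct (IVT_interv f a b) as [z Hz]; auto; [|now exists z].
  intros t Ht; apply continuity_pt_filterlim.
  apply (ex_derive_continuous (V := R_NormedModule)), Hd, Ht.
Qed.

(** Monotonicity is proved for [K], which is P'', rather than for [inflection]; the positive
    exponential factor changes neither signs nor zeros. *)
Lemma inflection_unique_root (w : nat -> R) (s d p q : R) :
  (forall z, p < z < q -> regular_at n w x z) ->
  (forall z, p < z < q ->
     0 < 3 * s * (powsum n w x 1 z ^ 2 - powsum n w x 2 z)
         + (s * z + d) * (powsum n w x 1 z ^ 3
            - 3 * powsum n w x 1 z * powsum n w x 2 z + 2 * powsum n w x 3 z)) ->
  (exists a b, p < a < b /\ b < q /\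
     inflection n w x s d a < 0 /\ 0 < inflection n w x s d b) ->
  exists z, p < z < q /\ inflection n w x s d z = 0 /\
    forall y, p < y < q -> inflection n w x s d y = 0 -> y = z.
Proof.
  intros Hr Hp (a & b & Hab & Hbq & Ha & Hb').
  set (K := fun z => exp (logsum n w x z) * inflection n w x s d z).
  assert (HK : forall z, p < z < q -> ex_derive K z)
    by (intros z Hz; eexists; apply is_derive_exp_inflection, Hr, Hz).
  destruct (IVT_root K a b) as [z [Hz HKz]]; [lra | | | |].
  - intros z Hz; apply HK; lra.
  - unfold K; assert (H := exp_pos (logsum n w x a)); nra.
  - unfold K; assert (H := exp_pos (logsum n w x b)); nra.
  - assert (Hinc : forall u v, p < u -> v < q -> u < v -> K u < K v).
    { intros u v Hu Hv Huv; eapply (is_derive_lt K); [exact Huv | |].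
      - intros t Ht; apply is_derive_exp_inflection, Hr; lra.
      - intros t Ht; apply Rmult_lt_0_compat; [apply exp_pos | apply Hp; lra]. }
    exists z; repeat split; try lra.
    + apply Rmult_eq_reg_l with (exp (logsum n w x z)); [|apply Rgt_not_eq, exp_pos].
      now rewrite Rmult_0_r.
    + intros y Hy Hy0.
      assert (HKy : K y = 0) by (unfold K; rewrite Hy0; ring).
      destruct (Rtotal_order y z) as [H|[H|H]]; [exfalso | exact H | exfalso].
      * assert (H1 := Hinc y z ltac:(lra) ltac:(lra) H); lra.
      * assert (H1 := Hinc z y ltac:(lra) ltac:(lra) H); lra.
Qed.

(** * Splitting off a pole, and local models of T *)

Definition drop (l : nat) (w : nat -> R) (i : nat) : R :=
  if Nat.eqb i l then 0 else w i.

Lemma drop_same (l : nat) (w : nat -> R) : drop l w l = 0.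
Proof. unfold drop; now rewrite Nat.eqb_refl. Qed.

Lemma drop_other (l i : nat) (w : nat -> R) : i <> l -> drop l w i = w i.
Proof. intros H; unfold drop; now rewrite (proj2 (Nat.eqb_neq i l)). Qed.

Lemma sum_drop (w : nat -> R) (F : nat -> R) (l : nat) :
  (l <= n)%nat ->
  sum_f_R0 (fun i => w i * F i) n = sum_f_R0 (fun i => drop l w i * F i) n + w l * F l.
Proof.
  intros Hl; apply (sum_f_R0_split_at (fun i => w i * F i)); [exact Hl | |].
  - rewrite drop_same; ring.
  - intros i Hi; now rewrite drop_other.
Qed.

Lemma powsum_drop (w : nat -> R) (l p : nat) (z : R) :
  (l <= n)%nat ->
  powsum n w x p z = powsum n (drop l w) x p z + w l * (/ (z - x l)) ^ p.
Proof. intros Hl; unfold powsum; now rewrite (sum_drop w _ l). Qed.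

Lemma logsum_drop (w : nat -> R) (l : nat) (z : R) :
  (l <= n)%nat ->
  logsum n w x z = logsum n (drop l w) x z + w l * ln (Rabs (z - x l)).
Proof. intros Hl; unfold logsum; now rewrite (sum_drop w _ l). Qed.

Lemma x_neq (i j : nat) : (i <= n)%nat -> (j <= n)%nat -> i <> j -> x i <> x j.
Proof.
  intros Hi Hj Hij; destruct (Nat.lt_gt_cases i j) as [[H|H] _]; auto.
  - assert (H1 := x_lt i j ltac:(lia)); lra.
  - assert (H1 := x_lt j i ltac:(lia)); lra.
Qed.

Lemma regular_drop_self (l : nat) (w : nat -> R) :
  (l <= n)%nat -> regular_at n (drop l w) x (x l).
Proof.
  intros Hl i Hi; destruct (Nat.eq_dec i l) as [->|H].
  - left; apply drop_same.
  - right; now apply x_neq; auto.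
Qed.

Lemma continuous_sign (f : R -> R) (a : R) :
  ex_derive f a -> 0 < f a -> exists eps, 0 < eps /\ forall z, Rabs (z - a) < eps -> 0 < f z.
Proof.
  intros Hd Ha.
  apply (ex_derive_continuous (V := R_NormedModule)) in Hd.
  destruct (Hd (fun y => 0 < y)) as [eps He].
  - exists (mkposreal _ Ha); intros y Hy.
    unfold ball in Hy; simpl in Hy; unfold AbsRing_ball, abs, minus, plus, opp in Hy;
      simpl in Hy; apply Rabs_def2 in Hy; lra.
  - exists eps; split; [apply cond_pos | intros z Hz; now apply He].
Qed.

(* Multiplying by [(z - x i)^2] removes the pole and leaves the value
   [W i ^ 2 - W i] at [x i]. *)
Lemma pole_sign (i : nat) :
  (i <= n)%nat -> W i ^ 2 - W i <> 0 ->
  exists eps, 0 < eps /\ forall z, z <> x i -> Rabs (z - x i) < eps ->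
    0 < (W i ^ 2 - W i) * (T z ^ 2 - powsum n W x 2 z).
Proof.
  intros Hi Hc.
  set (r := powsum n (drop i W) x 1); set (r2 := powsum n (drop i W) x 2).
  set (c := W i ^ 2 - W i) in *.
  set (f := fun z => c * (c + 2 * W i * (z - x i) * r z
                             + (z - x i) ^ 2 * (r z ^ 2 - r2 z))).
  destruct (continuous_sign f (x i)) as [eps [He Hf]].
  - assert (Hr := regular_drop_self i W Hi).
    assert (H1 : ex_derive r (x i)) by (eexists; now apply is_derive_powsum).
    assert (H2 : ex_derive r2 (x i)) by (eexists; now apply is_derive_powsum).
    unfold f; auto_derive; auto.
  - unfold f; rewrite Rminus_diag; nra.
  - exists eps; split; [exact He|]; intros z Hz Hd.
    specialize (Hf z Hd).
    rewrite (powsum_drop W i 1), (powsum_drop W i 2) by exact Hi.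
    fold r r2.
    apply Rmult_lt_reg_l with ((z - x i) ^ 2); [apply pow2_gt_0; lra|].
    rewrite Rmult_0_r; eapply Rlt_le_trans; [exact Hf|].
    apply Req_le; unfold f, c; field; lra.
Qed.

(* Near [z], T = s/h + sum_i w_i / (z - x i) with h = s z + d: either s = 0, h = +-1 and
   [w] is the full weight, or s = 1 and the pole at a point [x l] joining two arcs
   (where [W l = 1]) is split off, so that h and [w] stay regular across it. *)
Definition local_model (w : nat -> R) (s d z : R) : Prop :=
  regular_at n w x z /\
  ((frozen z /\ s * z + d <> 0 /\
    T z * (s * z + d) = s + (s * z + d) * powsum n w x 1 z /\
    logsum n W x z = logsum n w x z + ln (Rabs (s * z + d))) \/
   exists l, (1 <= l <= n - 1)%nat /\ beta l = -1 /\ beta (S l) = 1 /\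
     z = x l /\ w = drop l W /\ s = 1 /\ d = - x l).

Lemma local_model_frozen (z d : R) :
  frozen z -> d = 1 \/ d = -1 -> local_model W 0 d z.
Proof.
  intros Hz Hd; destruct (frozen_admissible z Hz) as [Hp _].
  split; [intros i Hi; right; now apply Hp | left].
  replace (0 * z + d) with d by ring.
  split; [exact Hz | split; [lra | split; [ring|]]].
  replace (Rabs d) with 1; [rewrite ln_1; ring|].
  destruct Hd as [-> | ->]; [now rewrite Rabs_R1 | now rewrite Rabs_m1].
Qed.

Lemma weight_at (i : nat) :
  (1 <= i <= n - 1)%nat -> W i = / 2 * (beta (S i) - beta i).
Proof. intros Hi; unfold weight; now rewrite !bext_mid by lia. Qed.

Lemma join_weight (l : nat) :
  (1 <= l <= n - 1)%nat -> beta l = -1 -> beta (S l) = 1 -> W l = 1.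
Proof. intros Hl H1 H2; rewrite weight_at, H1, H2 by exact Hl; lra. Qed.

Lemma bext_range (i : nat) : (i <= S n)%nat -> -1 <= bext n beta i <= 1.
Proof.
  intros Hi; destruct (Nat.eq_dec i 0) as [->|H0]; [rewrite bext_0; lra|].
  destruct (Nat.eq_dec i (S n)) as [->|H1]; [rewrite bext_last; lra|].
  rewrite bext_mid by lia; apply Hb; lia.
Qed.

(** A slope -1 can only be reached by a decrease. The negative weight makes [W ^ 2 - W] positive,
    which fixes the sign of [T^2 - powsum 2] at the end of the arc away from the corner. *)
Lemma weight_before_descent (l : nat) :
  (1 <= l <= n)%nat -> beta l = -1 -> W (l - 1)%nat < 0.
Proof.
  intros Hl H; unfold weight; replace (S (l - 1)) with l by lia.
  assert (H1 := Hne (l - 1)%nat ltac:(lia)); replace (S (l - 1)) with l in H1 by lia.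
  assert (H2 := bext_range (l - 1) ltac:(lia)).
  rewrite (bext_mid n beta l), H in * by lia; lra.
Qed.

Lemma weight_after_ascent (l : nat) :
  (1 <= l <= n)%nat -> beta l = 1 -> W l < 0.
Proof.
  intros Hl H; unfold weight.
  assert (H1 := Hne l ltac:(lia)); assert (H2 := bext_range (S l) ltac:(lia)).
  rewrite (bext_mid n beta l), H in * by lia; lra.
Qed.

Lemma join_neighbourhood (l : nat) (z : R) :
  (1 <= l <= n - 1)%nat -> beta l = -1 -> beta (S l) = 1 ->
  x (l - 1)%nat < z < x (S l) -> z <> x l ->
  frozen z /\ 0 < (z - x l) * T z.
Proof.
  intros Hl H1 H2 Hz Hzl; destruct (Rlt_dec z (x l)) as [H|H].
  - assert (H3 : S (l - 1) = l) by lia.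
    destruct (descending_location z (l - 1)) as [HT _];
      [lia | now rewrite H3 | rewrite H3; lra|].
    split; [|nra].
    right; right; exists (l - 1)%nat; rewrite H3; repeat split; try tauto; try lra; lia.
  - destruct (ascending_location z l) as [HT _]; [lia | exact H2 | lra |].
    split; [|nra].
    right; right; exists l; repeat split; try tauto; try lra; lia.
Qed.

Lemma local_model_join (l : nat) (z : R) :
  (1 <= l <= n - 1)%nat -> beta l = -1 -> beta (S l) = 1 ->
  x (l - 1)%nat < z < x (S l) -> local_model (drop l W) 1 (- x l) z.
Proof.
  intros Hl H1 H2 Hz; destruct (Req_dec z (x l)) as [->|Hzl].
  - split; [apply regular_drop_self; lia | right; exists l; tauto].
  - destruct (join_neighbourhood l z Hl H1 H2 Hz Hzl) as [Hf _].
    destruct (frozen_admissible z Hf) as [Hp _].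
    split; [intros i Hi; right; now apply Hp | left].
    replace (1 * z + - x l) with (z - x l) by ring.
    rewrite (powsum_drop W l 1), (logsum_drop W l), join_weight by (auto; lia).
    split; [exact Hf | split; [lra | split; [field; lra | ring]]].
Qed.

(** Giving [d] the sign of T turns the inequality for the quotient by T into positivity of P'''. *)
Lemma third_order_model_frozen (z d : R) :
  frozen z -> 0 < d * T z ->
  0 < 3 * 0 * (powsum n W x 1 z ^ 2 - powsum n W x 2 z)
      + (0 * z + d) * (powsum n W x 1 z ^ 3
          - 3 * powsum n W x 1 z * powsum n W x 2 z + 2 * powsum n W x 3 z).
Proof.
  intros Hz Hd; assert (H := third_order_frozen z Hz).
  assert (HT : T z <> 0) by nra.
  eapply Rlt_le_trans; [apply (Rmult_lt_0_compat _ _ Hd H)|].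
  apply Req_le; field; exact HT.
Qed.

(** Away from the corner, [W l = 1] makes the expression [z - x l] times the third order expression
    with full weights. At the corner only the term with factor 3 survives, and there [powsum 2] is
    negative. *)
Lemma third_order_model_join (l : nat) (z : R) :
  (1 <= l <= n - 1)%nat -> beta l = -1 -> beta (S l) = 1 ->
  x (l - 1)%nat < z < x (S l) ->
  let w := drop l W in
  0 < 3 * 1 * (powsum n w x 1 z ^ 2 - powsum n w x 2 z)
      + (1 * z + - x l) * (powsum n w x 1 z ^ 3
          - 3 * powsum n w x 1 z * powsum n w x 2 z + 2 * powsum n w x 3 z).
Proof.
  intros Hl H1 H2 Hz w; unfold w.
  assert (Hw := join_weight l Hl H1 H2).
  destruct (Req_dec z (x l)) as [->|Hzl].
  - assert (H := join_second_order l Hl H1 H2).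
    rewrite (powsum_drop W l 2), Hw, Rminus_diag, Rinv_0 in H by lia; nra.
  - destruct (join_neighbourhood l z Hl H1 H2 Hz Hzl) as [Hf HT].
    assert (H := third_order_frozen z Hf).
    assert (HT0 : T z <> 0) by nra.
    eapply Rlt_le_trans; [apply (Rmult_lt_0_compat _ _ HT H)|].
    apply Req_le.
    transitivity ((z - x l) * (T z ^ 3 - 3 * T z * powsum n W x 2 z
                               + 2 * powsum n W x 3 z)); [field; exact HT0|].
    rewrite (powsum_drop W l 1), (powsum_drop W l 2), (powsum_drop W l 3), Hw by lia.
    field; lra.
Qed.

(** The point [m] keeps the two witnesses apart; taken at the corner of a joined arc, it also keeps
    both of them off the corner. *)
Lemma end_signs (i j : nat) (m : R) :
  (i <= n)%nat -> (j <= n)%nat -> x i < m < x j ->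
  W i ^ 2 - W i <> 0 -> W j ^ 2 - W j <> 0 ->
  exists a b, x i < a < m /\ m < b < x j /\
    0 < (W i ^ 2 - W i) * (T a ^ 2 - powsum n W x 2 a) /\
    0 < (W j ^ 2 - W j) * (T b ^ 2 - powsum n W x 2 b).
Proof.
  intros Hi Hj Hm Hci Hcj.
  destruct (pole_sign i Hi Hci) as [e1 [He1 H1]].
  destruct (pole_sign j Hj Hcj) as [e2 [He2 H2]].
  assert (M1 : 0 < Rmin e1 (m - x i)) by (apply Rmin_glb_lt; lra).
  assert (M2 : 0 < Rmin e2 (x j - m)) by (apply Rmin_glb_lt; lra).
  assert (M3 := Rmin_l e1 (m - x i)); assert (M4 := Rmin_r e1 (m - x i)).
  assert (M5 := Rmin_l e2 (x j - m)); assert (M6 := Rmin_r e2 (x j - m)).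
  exists (x i + Rmin e1 (m - x i) / 2), (x j - Rmin e2 (x j - m) / 2).
  repeat split; try lra.
  - apply H1; [lra | apply Rabs_def1; lra].
  - apply H2; [lra | apply Rabs_def1; lra].
Qed.

(** * The root on the arc of an outer corner *)

Definition corner_arc (l : nat) (z : R) : Prop :=
  (lattice (beta l) /\ x (l - 1)%nat < z < x l) \/
  (lattice (beta (S l)) /\ x l < z < x (S l)) \/
  (lattice (beta l) /\ lattice (beta (S l)) /\ z = x l).

(** At an end away from the corner the weight is negative, so [W ^ 2 - W > 0]. With one lattice
    slope the corner has [0 < W < 1], hence the opposite sign. With two lattice slopes the arcs join
    into one interval, both of whose ends have [W ^ 2 - W > 0], and the change of sign comes from
    the factor [z - x l]. *)
Lemma corner_unique_inflection (l : nat) :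
  lattice_outer_corner n beta l ->
  exists w s d p q,
    (forall z, corner_arc l z <-> p < z < q) /\
    (forall z, p < z < q -> local_model w s d z) /\
    exists z, p < z < q /\ inflection n w x s d z = 0 /\
      forall y, p < y < q -> inflection n w x s d y = 0 -> y = z.
Proof.
  intros (Hl & Hlt & Hlat).
  assert (B1 := Hb l ltac:(lia)); assert (B2 := Hb (S l) ltac:(lia)).
  assert (X1 := x_lt (l - 1) l ltac:(lia)); assert (X2 := x_lt l (S l) ltac:(lia)).
  assert (HS : S (l - 1) = l) by lia.
  assert (Hw := weight_at l Hl).
  assert (Ll : lattice (beta l) <-> beta l = -1) by (unfold lattice; lra).
  assert (Lr : lattice (beta (S l)) <-> beta (S l) = 1) by (unfold lattice; lra).
  destruct (Req_dec (beta l) (-1)) as [H1|H1];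
    destruct (Req_dec (beta (S l)) 1) as [H2|H2].
  - exists (drop l W), 1, (- x l), (x (l - 1)%nat), (x (S l)).
    split; [|split].
    + intros z; unfold corner_arc; rewrite Ll, Lr; lra.
    + intros z Hz; now apply local_model_join.
    + apply inflection_unique_root.
      * intros z Hz; now apply local_model_join.
      * intros z Hz; now apply third_order_model_join.
      * assert (W1 := weight_before_descent l ltac:(lia) H1).
        assert (W2 := weight_after_ascent (S l) ltac:(lia) H2).
        destruct (end_signs (l - 1) (S l) (x l)) as (a & b & Ha & Hb' & Sa & Sb);
          [lia | lia | lra | nra | nra |].
        assert (Hi : forall z, z <> x l -> inflection n (drop l W) x 1 (- x l) z
                     = (z - x l) * (T z ^ 2 - powsum n W x 2 z)).
        { intros z Hz; unfold inflection.
          rewrite (powsum_drop W l 1), (powsum_drop W l 2) by lia.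
          rewrite join_weight by auto; field; lra. }
        exists a, b; rewrite !Hi by lra; repeat split; try lra.
        -- assert (0 < W (l - 1)%nat ^ 2 - W (l - 1)%nat) by nra; nra.
        -- assert (0 < W (S l) ^ 2 - W (S l)) by nra; nra.
  - assert (Hf : forall z, x (l - 1)%nat < z < x l -> frozen z).
    { intros z Hz; right; right; exists (l - 1)%nat; rewrite HS; repeat split;
        try tauto; try lra; lia. }
    exists W, 0, (-1), (x (l - 1)%nat), (x l).
    split; [|split].
    + intros z; unfold corner_arc; rewrite Ll, Lr; lra.
    + intros z Hz; apply local_model_frozen; [now apply Hf | lra].
    + apply inflection_unique_root.
      * intros z Hz; apply (local_model_frozen z (-1)); [now apply Hf | lra].
      * intros z Hz; apply third_order_model_frozen; [now apply Hf|].
        destruct (descending_location z (l - 1)); rewrite ?HS; auto; lra || lia.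
      * assert (W1 := weight_before_descent l ltac:(lia) H1).
        destruct (end_signs (l - 1) l ((x (l - 1)%nat + x l) / 2))
          as (a & b & Ha & Hb' & Sa & Sb);
          [lia | lia | lra | nra | rewrite Hw, H1; nra |].
        exists a, b; unfold inflection; repeat split; try lra.
        -- assert (0 < W (l - 1)%nat ^ 2 - W (l - 1)%nat) by nra; nra.
        -- assert (W l ^ 2 - W l < 0) by (rewrite Hw, H1; nra); nra.
  - assert (Hf : forall z, x l < z < x (S l) -> frozen z).
    { intros z Hz; right; right; exists l; repeat split;
        try tauto; try lra; lia. }
    exists W, 0, 1, (x l), (x (S l)).
    split; [|split].
    + intros z; unfold corner_arc; rewrite Ll, Lr; lra.
    + intros z Hz; apply local_model_frozen; [now apply Hf | lra].
    + apply inflection_unique_root.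
      * intros z Hz; apply (local_model_frozen z 1); [now apply Hf | lra].
      * intros z Hz; apply third_order_model_frozen; [now apply Hf|].
        destruct (ascending_location z l); auto; lra || lia.
      * assert (W1 := weight_after_ascent (S l) ltac:(lia) H2).
        destruct (end_signs l (S l) ((x l + x (S l)) / 2))
          as (a & b & Ha & Hb' & Sa & Sb);
          [lia | lia | lra | rewrite Hw, H2; nra | nra |].
        exists a, b; unfold inflection; repeat split; try lra.
        -- assert (W l ^ 2 - W l < 0) by (rewrite Hw, H2; nra); nra.
        -- assert (0 < W (S l) ^ 2 - W (S l)) by nra; nra.
  - exfalso; tauto.
Qed.

End Backwall.

(** * The coordinates tau and chi along the curve *)

Definition node (V : nat -> R) (i : nat) : R := exp (V i).

Lemma lg_off_pole (z v : R) : z <> exp v -> lg z v = ln (Rabs (z - exp v)) - v.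
Proof.
  intros H; unfold lg.
  replace (z * exp (- v) - 1) with ((z - exp v) * exp (- v)).
  - rewrite Rabs_mult, ln_mult.
    + rewrite (Rabs_right (exp (- v))), ln_exp by (left; apply exp_pos); ring.
    + apply Rabs_pos_lt; lra.
    + apply Rabs_pos_lt, Rgt_not_eq, exp_pos.
  - rewrite exp_Ropp; field; apply Rgt_not_eq, exp_pos.
Qed.

Section Curve.

Context (n : nat) (V beta : nat -> R) (v0 : R).
Context (Hn : (1 <= n)%nat)
        (HV : forall i, (i < n)%nat -> V i < V (S i))
        (Hb : forall i, (1 <= i <= n)%nat -> -1 <= beta i <= 1)
        (Hne : forall i, (i <= n)%nat -> bext n beta i <> bext n beta (S i)).

Local Notation W := (weight n beta).
Local Notation x := (node V).
Local Notation T := (powsum n W x 1).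
Local Notation E z := (z - invT n V beta z).

Lemma node_lt (i : nat) : (i < n)%nat -> x i < x (S i).
Proof. intros Hi; now apply exp_increasing, HV. Qed.

Lemma Tfun_powsum (z : R) : Tfun n V beta z = T z.
Proof. unfold Tfun, powsum; apply sum_eq; intros; unfold weight, node, Rdiv; ring. Qed.

Lemma in_U_frozen (z : R) : in_U n V beta z <-> frozen n x beta z.
Proof.
  unfold in_U, frozen, node, lattice; split; intros [H|[H|(i & Hi & Hl & Hz)]]; auto.
  - right; right; exists (i - 1)%nat; replace (S (i - 1)) with i by lia.
    split; [lia | tauto].
  - right; right; exists (S i); replace (S i - 1)%nat with i by lia.
    split; [lia | tauto].
Qed.

Lemma invT_frozen (z : R) : frozen n x beta z -> invT n V beta z = / T z.
Proof.
  intros Hz; destruct (frozen_admissible n x beta Hn node_lt Hb Hne z Hz) as [Hp _].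
  unfold invT; destruct (excluded_middle_informative (is_pole n V _)) as [(i & Hi & He)|_].
  - exfalso; now apply (Hp i).
  - now rewrite Tfun_powsum.
Qed.

Lemma invT_pole (l : nat) : (l <= n)%nat -> invT n V beta (x l) = 0.
Proof.
  intros Hl; unfold invT; destruct (excluded_middle_informative (is_pole n V _)) as [_|H]; auto.
  exfalso; apply H; now exists l.
Qed.

Lemma curve_admissible (z : R) :
  in_U n V beta z \/ join_point n V beta z ->
  admissible n x beta z (E z) /\ (z = E z \/ T z = / (z - E z)).
Proof.
  intros [Hz|(l & Hl & H1 & H2 & ->)].
  - apply in_U_frozen in Hz.
    destruct (frozen_admissible n x beta Hn node_lt Hb Hne z Hz) as (_ & HT & Ha).
    rewrite invT_frozen by exact Hz; split; [exact Ha | right].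
    replace (z - (z - / T z)) with (/ T z) by ring; now rewrite Rinv_inv.
  - change (exp (V l)) with (x l); rewrite invT_pole, Rminus_0_r by lia.
    split; [|now left]; now apply (join_admissible n x beta Hn node_lt).
Qed.

Lemma curve_tau (z : R) :
  in_U n V beta z \/ join_point n V beta z ->
  0 < E z /\ exp (tau_of n V beta z) = E z /\
  V 0%nat <= tau_of n V beta z <= V n.
Proof.
  intros Hz; destruct (curve_admissible z Hz) as [[HE _] _].
  assert (H0 := exp_pos (V 0%nat)); unfold node in HE.
  assert (Hpos : 0 < E z) by lra.
  unfold tau_of; rewrite exp_ln by exact Hpos.
  repeat split; try exact Hpos; left; apply exp_lt_inv; rewrite exp_ln; lra.
Qed.

Definition chi_const : R :=
  / 2 * (v0 + V 0%nat) - sum_f_R0 (fun i => W i * V i) n.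

(** [weighted_sum_clamp] for [lg z] in the variable V removes the segments from chi. The shift [t]
    coming from [lg z t] turns the [- t / 2] of [chi_of] into [+ t / 2]. *)
Lemma chi_curve (z : R) :
  in_U n V beta z \/ join_point n V beta z ->
  chi_of n V beta v0 z =
  logsum n W x z - ln (Rabs (z - E z)) + tau_of n V beta z / 2 + chi_const.
Proof.
  intros Hz; destruct (curve_tau z Hz) as (HE & Hexp & Htau).
  unfold chi_of; cbv zeta.
  rewrite <- (weighted_sum_clamp n beta V (lg z)) by auto.
  set (t := tau_of n V beta z) in *.
  enough (H : sum_f_R0 (fun i => W i * lg z (V i)) n - lg z t =
    logsum n W x z - ln (Rabs (z - E z)) - sum_f_R0 (fun i => W i * V i) n + t)
    by (rewrite H; unfold chi_const; field).
  destruct Hz as [Hz|(l & Hl & H1 & H2 & Hzl)].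
  - apply in_U_frozen in Hz.
    destruct (frozen_admissible n x beta Hn node_lt Hb Hne z Hz) as (Hp & HT & _).
    rewrite (lg_off_pole z t), Hexp.
    + assert (Hs : sum_f_R0 (fun i => W i * lg z (V i)) n =
        logsum n W x z - sum_f_R0 (fun i => W i * V i) n).
      { unfold logsum; rewrite <- minus_sum; apply sum_eq; intros i Hi.
        rewrite lg_off_pole by now apply Hp.
        unfold node; ring. }
      rewrite Hs; ring.
    + rewrite Hexp, invT_frozen by exact Hz.
      assert (H := Rinv_neq_0_compat _ HT); lra.
  (* At a join point E = z, so logarithms of 0 occur on both sides. Since [W l = 1], the one in the
     sum cancels the one subtracted, whatever their default value. *)
  - assert (Ht : t = V l).
    { apply exp_inv; rewrite Hexp, Hzl.
      change (exp (V l)) with (x l); rewrite invT_pole by lia; ring. }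
    assert (HEz : E z = z)
      by (rewrite Hzl; change (exp (V l)) with (x l); rewrite invT_pole by lia; ring).
    rewrite HEz, Ht.
    rewrite (sum_drop n W (fun i => lg z (V i)) l), (sum_drop n W V l),
      (logsum_drop n x W l), (join_weight n beta Hn l) by (auto; lia).
    change (x l) with (exp (V l)); rewrite <- Hzl.
    assert (Hs : sum_f_R0 (fun i => drop l W i * lg z (V i)) n =
      logsum n (drop l W) x z - sum_f_R0 (fun i => drop l W i * V i) n).
    { unfold logsum; rewrite <- minus_sum; apply sum_eq; intros i Hi.
      destruct (Nat.eq_dec i l) as [->|Hil]; [rewrite drop_same; ring|].
      rewrite lg_off_pole.
      - unfold node; ring.
      - rewrite Hzl; apply not_eq_sym, (x_neq n x Hn node_lt); auto; lia. }
    rewrite Hs; ring.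
Qed.

(** * Smooth charts and derivatives of the curve *)

Lemma local_model_curve (w : nat -> R) (s d z : R) :
  local_model n x beta w s d z -> in_U n V beta z \/ join_point n V beta z.
Proof.
  intros (_ & [(Hz & _)|(l & Hl & H1 & H2 & H3 & _)]).
  - left; now apply in_U_frozen.
  - right; now exists l.
Qed.

(** Here [m] is h T with h = s z + d. Thus 1/T = h/m, and the [ln |h|] split off from the potential
    cancels against [ln |T| = ln |m| - ln |h|]. What remains is smooth across a join point, where
    [m = 1]. *)
Lemma local_model_chart (w : nat -> R) (s d z : R) :
  local_model n x beta w s d z ->
  let m := s + (s * z + d) * powsum n w x 1 z in
  m <> 0 /\ invT n V beta z = (s * z + d) / m /\
  chi_of n V beta v0 z =
    logsum n w x z + ln (Rabs m) + tau_of n V beta z / 2 + chi_const.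
Proof.
  intros Hm m; assert (Hc := local_model_curve w s d z Hm).
  rewrite (chi_curve z Hc).
  destruct Hm as (_ & [(Hz & Hh & HT & HL)|(l & Hl & H1 & H2 & -> & -> & -> & ->)]).
  - destruct (frozen_admissible n x beta Hn node_lt Hb Hne z Hz) as (_ & HT0 & _).
    fold m in HT.
    assert (Hm0 : m <> 0)
      by (rewrite <- HT; now apply Rmult_integral_contrapositive_currified).
    rewrite invT_frozen by exact Hz.
    split; [exact Hm0 | split; [rewrite <- HT; now field|]].
    replace (z - (z - / T z)) with (/ T z) by ring.
    rewrite HL, <- HT, Rabs_mult, Rabs_inv, ln_mult, ln_Rinv
      by now apply Rabs_pos_lt.
    ring.
  - unfold m; replace (1 * x l + - x l) with 0 by ring.
    rewrite invT_pole by lia.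
    rewrite (logsum_drop n x W l), (join_weight n beta Hn l) by (auto; lia).
    split; [lra | split; [unfold Rdiv; ring|]].
    rewrite Rmult_0_l, Rplus_0_r, Rabs_R1, ln_1, Rminus_0_r.
    ring.
Qed.
(** The model must hold on a neighbourhood since [tau_of] and [chi_of] are replaced by their charts
    before differentiating. At a join point h = 0, so the derivative of tau vanishes in any case and
    it is chi, through [inflection / m], that detects a cusp. *)
Lemma local_model_derive (w : nat -> R) (s d z : R) :
  locally z (local_model n x beta w s d) ->
  let m := s + (s * z + d) * powsum n w x 1 z in
  let dtau := (s * z + d) * inflection n w x s d z / (m ^ 2 * E z) in
  m <> 0 /\
  is_derive (tau_of n V beta) z dtau /\
  is_derive (chi_of n V beta v0) z (inflection n w x s d z / m + dtau / 2).
Proof.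
  intros Hloc m dtau.
  assert (Hz := locally_singleton _ _ Hloc).
  destruct (local_model_chart w s d z Hz) as (Hm & HE & _); fold m in Hm, HE.
  destruct (curve_tau z (local_model_curve w s d z Hz)) as (Hpos & _).
  destruct Hz as [Hreg _].
  assert (D1 := is_derive_powsum n w x 1 z Hreg); simpl INR in D1.
  assert (DL := is_derive_logsum n w x z Hreg).
  set (r := powsum n w x 1) in *; set (L := logsum n w x) in *.
  set (M := fun y => s + (s * y + d) * r y).
  assert (Dr : Derive (fun y => r y) z = - 1 * powsum n w x 2 z)
    by apply is_derive_unique, D1.
  assert (Htau : is_derive (tau_of n V beta) z dtau).
  { apply is_derive_ext_loc with (fun y => ln (y - (s * y + d) / M y)).
    - apply filter_imp with (2 := Hloc); intros y Hy.
      destruct (local_model_chart w s d y Hy) as (_ & H & _).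
      unfold tau_of; rewrite H; reflexivity.
    - rewrite HE in Hpos; unfold M; auto_derive.
      + repeat split; try (eexists; exact D1); try exact Hm.
        exact Hpos.
      + rewrite Dr; unfold dtau, inflection; rewrite HE; fold r.
        unfold m in *; field.
        split; [exact Hm|].
        (* The denominator z m - h is E m, a product of non-zero factors. *)
        replace (z * (s + (s * z + d) * r z) - (s * z + d)) with
          ((z - (s * z + d) / (s + (s * z + d) * r z)) * (s + (s * z + d) * r z))
          by (field; exact Hm).
        apply Rmult_integral_contrapositive_currified; [lra | exact Hm]. }
  split; [exact Hm | split; [exact Htau|]].
  assert (DM : is_derive M z (s * r z + (s * z + d) * (- 1 * powsum n w x 2 z))).
  { unfold M; auto_derive; [repeat split; eexists; exact D1 | rewrite Dr; ring]. }
  assert (DlnM := is_derive_comp (fun y => ln (Rabs y)) M z _ _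
                    (is_derive_ln_Rabs (M z) Hm) DM).
  apply is_derive_ext_loc with
    (fun y => L y + ln (Rabs (M y)) + tau_of n V beta y / 2 + chi_const).
  - apply filter_imp with (2 := Hloc); intros y Hy.
    destruct (local_model_chart w s d y Hy) as (_ & _ & H).
    symmetry; exact H.
  - set (N := fun y => ln (Rabs (M y))) in *.
    change (is_derive (fun y => L y + N y + tau_of n V beta y / 2 + chi_const) z
      (inflection n w x s d z / m + dtau / 2)).
    auto_derive.
    + repeat split; try (eexists; eassumption).
    + replace (Derive (fun y => L y) z) with (r z)
        by (symmetry; apply is_derive_unique, DL).
      replace (Derive (fun y => N y) z) with
        (/ M z * (s * r z + (s * z + d) * (- 1 * powsum n w x 2 z)))
        by (symmetry; rewrite Rmult_comm; apply is_derive_unique, DlnM).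
      replace (Derive (fun y => tau_of n V beta y) z) with dtau
        by (symmetry; apply is_derive_unique, Htau).
      change (M z) with m; unfold inflection; fold r.
      unfold m in *; field; exact Hm.
Qed.

Lemma cusp_inflection (w : nat -> R) (s d z : R) :
  locally z (local_model n x beta w s d) ->
  (cusp_param n V beta v0 z <-> inflection n w x s d z = 0).
Proof.
  intros Hloc.
  destruct (local_model_derive w s d z Hloc) as (Hm & Ht & Hc).
  assert (Hcv := local_model_curve w s d z (locally_singleton _ _ Hloc)).
  split.
  - intros (_ & Ht0 & Hc0).
    assert (H1 := eq_trans (eq_sym (is_derive_unique _ _ _ Ht)) (is_derive_unique _ _ _ Ht0)).
    assert (H2 := eq_trans (eq_sym (is_derive_unique _ _ _ Hc)) (is_derive_unique _ _ _ Hc0)).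
    rewrite H1 in H2.
    assert (H3 := f_equal (fun y => y * (s + (s * z + d) * powsum n w x 1 z)) H2).
    simpl in H3; field_simplify in H3; [lra | exact Hm].
  - intros H; rewrite H in Ht, Hc.
    replace (_ / _) with 0 in Ht by (unfold Rdiv; ring).
    replace (_ + _) with 0 in Hc by (unfold Rdiv; ring).
    destruct (curve_tau z Hcv) as [Hpos _].
    split; [now split | now split].
Qed.

(** * Cusps on the components *)

Lemma frozen_open (z : R) : frozen n x beta z -> locally z (frozen n x beta).
Proof.
  intros [H|[H|(j & Hj & Hbj & H)]].
  - apply filter_imp with (2 := open_lt _ z H); now left.
  - apply filter_imp with (2 := open_gt _ z H); now right; left.
  - destruct H as [H1 H2].
    apply filter_imp with (2 := filter_and _ _ (open_gt _ z H1) (open_lt _ z H2)).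
    intros y Hy; right; right; now exists j.
Qed.

Lemma component_unique_cusp (l : nat) :
  lattice_outer_corner n beta l ->
  exists z, component n V beta l z /\ cusp_param n V beta v0 z /\
    forall y, component n V beta l y -> cusp_param n V beta v0 y -> y = z.
Proof.
  intros Hl.
  destruct (corner_unique_inflection n x beta Hn node_lt Hb Hne l Hl)
    as (w & s & d & p & q & Harc & Hmod & z & Hz & Hz0 & Huniq).
  assert (Hloc : forall y, p < y < q -> locally y (local_model n x beta w s d)).
  { intros y [H1 H2].
    apply filter_imp with (2 := filter_and _ _ (open_gt _ y H1) (open_lt _ y H2)).
    exact Hmod. }
  exists z; split; [now apply Harc | split].
  - now apply (cusp_inflection w s d z (Hloc z Hz)).
  - intros y Hy Hc; apply Harc in Hy.
    apply Huniq; [exact Hy | now apply (cusp_inflection w s d y (Hloc y Hy))].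
Qed.

Lemma cusp_frozen_inflection (z : R) :
  frozen n x beta z -> cusp_param n V beta v0 z ->
  T z ^ 2 - powsum n W x 2 z = 0.
Proof.
  intros Hz Hc.
  assert (Hloc : locally z (local_model n x beta W 0 1)).
  { apply filter_imp with (2 := frozen_open z Hz); intros y Hy.
    apply (local_model_frozen n x beta Hn node_lt Hb Hne y 1 Hy); now left. }
  apply (cusp_inflection W 0 1 z Hloc) in Hc.
  unfold inflection in Hc; lra.
Qed.

(** A segment of slope 1 belongs to the outer corner at its left end and one of slope -1 to that at
    its right end. Where that end is an end of the whole wall, and outside the wall, P'' has no
    zero. *)
Lemma cusp_in_component (z : R) :
  cusp_param n V beta v0 z ->
  exists l, lattice_outer_corner n beta l /\ component n V beta l z.
Proof.
  intros Hc; destruct (proj1 (proj1 Hc)) as [Hz|(l & Hl & H1 & H2 & H3)].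
  - apply in_U_frozen in Hz.
    assert (H0 := cusp_frozen_inflection z Hz Hc).
    destruct Hz as [Hz|[Hz|(j & Hj & [Hbj|Hbj] & Hz)]].
    + exfalso; apply (outside_no_inflection n x beta Hn node_lt Hb Hne z); auto.
    + exfalso; apply (outside_no_inflection n x beta Hn node_lt Hb Hne z); auto.
    + destruct (Nat.eq_dec j 0) as [->|Hj0].
      { exfalso.
        now apply (first_segment_no_inflection n x beta Hn node_lt Hb Hne z). }
      exists j; split.
      * split; [lia | split; [|right; now left]].
        assert (H4 := Hne j ltac:(lia)); rewrite !bext_mid in H4 by lia.
        assert (H5 := Hb j ltac:(lia)); lra.
      * right; left; split; [now left | exact Hz].
    + destruct (Nat.eq_dec (S j) n) as [Hjn|Hjn].
      { exfalso.
        apply (last_segment_no_inflection n x beta Hn node_lt Hb Hne z).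
        - now rewrite <- Hjn.
        - now rewrite <- Hjn, Nat.sub_succ, Nat.sub_0_r.
        - exact H0. }
      exists (S j); split.
      * split; [lia | split; [|left; now right]].
        assert (H4 := Hne (S j) ltac:(lia)); rewrite !bext_mid in H4 by lia.
        assert (H5 := Hb (S (S j)) ltac:(lia)); lra.
      * left; split; [now right|]; now rewrite Nat.sub_succ, Nat.sub_0_r.
  - exists l; split.
    + split; [exact Hl | split; [lra | left; now right]].
    + right; right; split; [now right | split; [now left | exact H3]].
Qed.

(** The cusps are counted as points of the plane, so different parameters must not give the same
    point. Equal tau gives a common E, and equal chi then gives the equal logarithms that
    [tangency_unique] asks for. *)
Lemma cusp_point_inj (z1 z2 : R) :
  cusp_param n V beta v0 z1 -> cusp_param n V beta v0 z2 ->
  tau_of n V beta z1 = tau_of n V beta z2 ->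
  chi_of n V beta v0 z1 = chi_of n V beta v0 z2 -> z1 = z2.
Proof.
  intros [[H1 _] _] [[H2 _] _] Ht Hc.
  destruct (curve_admissible z1 H1) as [A1 T1].
  destruct (curve_admissible z2 H2) as [A2 T2].
  rewrite (chi_curve z1 H1), (chi_curve z2 H2), Ht in Hc.
  assert (HE : E z2 = E z1).
  { destruct (curve_tau z1 H1) as (_ & <- & _);
      destruct (curve_tau z2 H2) as (_ & <- & _); now rewrite Ht. }
  rewrite HE in *.
  apply (tangency_unique n x beta Hn node_lt Hb Hne z1 z2 (E z1)); auto; lra.
Qed.

(** Only neighbouring corners could overlap, on the segment between them. A lattice slope there
    would have to be 1 because the slope increases at the first corner, and -1 because it increases
    at the second. *)
Lemma component_disjoint (l l' : nat) (z : R) :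
  lattice_outer_corner n beta l -> lattice_outer_corner n beta l' ->
  component n V beta l z -> component n V beta l' z -> l = l'.
Proof.
  intros Hl Hl' Hz Hz'.
  enough (H : forall i j, lattice_outer_corner n beta i -> lattice_outer_corner n beta j ->
    component n V beta i z -> component n V beta j z -> (i < j)%nat -> False).
  { destruct (Nat.lt_trichotomy l l') as [H1|[H1|H1]]; [|exact H1|]; exfalso; eauto. }
  intros i j (Hi & Hib & _) (Hj & Hjb & _) Zi Zj Hij.
  assert (X1 := x_le n x Hn node_lt i (j - 1) ltac:(lia)).
  assert (X2 := x_le n x Hn node_lt (S i) j ltac:(lia)).
  assert (X3 := x_lt n x Hn node_lt i (S i) ltac:(lia)).
  assert (X4 := x_lt n x Hn node_lt (j - 1) j ltac:(lia)).
  assert (Zi' : z <= x i \/ lattice (beta (S i)) /\ z < x (S i))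
    by (unfold component, node in *; intuition lra).
  assert (Zj' : x j <= z \/ lattice (beta j) /\ x (j - 1)%nat < z)
    by (unfold component, node in *; intuition lra).
  destruct (Nat.eq_dec j (S i)) as [->|Hne'].
  - assert (B1 := Hb i ltac:(lia)); assert (B2 := Hb (S (S i)) ltac:(lia)).
    unfold lattice in *; lra.
  - assert (X5 := x_le n x Hn node_lt (S i) (j - 1) ltac:(lia)); lra.
Qed.
End Curve.

(** * Counting through matched lists *)

Lemma list_choice (A B : Type) (P : A -> B -> Prop) (ls : list A) :
  (forall l, In l ls -> exists b, P l b) -> exists bs, Forall2 P ls bs.
Proof.
  induction ls as [|l ls IH]; intros H; [now exists nil|].
  destruct (H l (or_introl eq_refl)) as [b Hb].
  destruct IH as [bs Hbs]; [intros; apply H; now right|].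
  exists (b :: bs); now constructor.
Qed.

Lemma Forall2_in_l (A B : Type) (P : A -> B -> Prop) ls bs :
  Forall2 P ls bs -> forall l, In l ls -> exists b, In b bs /\ P l b.
Proof.
  induction 1 as [|l b ls bs Hlb _ IH]; intros l' [].
  - subst; exists b; split; [now left | assumption].
  - destruct (IH l' H) as (b' & H1 & H2); exists b'; split; [now right | exact H2].
Qed.

Lemma Forall2_in_r (A B : Type) (P : A -> B -> Prop) ls bs :
  Forall2 P ls bs -> forall b, In b bs -> exists l, In l ls /\ P l b.
Proof. intros H; apply Forall2_flip in H; now apply Forall2_in_l. Qed.

Lemma Forall2_NoDup (A B : Type) (P : A -> B -> Prop) ls bs :
  (forall l l' b, In l ls -> In l' ls -> P l b -> P l' b -> l = l') ->
  Forall2 P ls bs -> NoDup ls -> NoDup bs.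
Proof.
  intros Hinj H; induction H as [|l b ls bs Hlb H IH]; intros Hnd; constructor;
    inversion_clear Hnd as [|? ? Hnin Hnd'].
  - intros Hin; destruct (Forall2_in_r _ _ _ _ _ H b Hin) as (l' & Hl' & Hb').
    apply Hnin; rewrite (Hinj l l' b); simpl; auto.
  - apply IH; [|exact Hnd'].
    intros l1 l2 b' H1 H2; apply Hinj; now right.
Qed.

Theorem theorem4p5 :
  forall (n : nat) (V beta : nat -> R) (v0 : R),
    (1 <= n)%nat ->
    (forall i, (i < n)%nat -> V i < V (S i)) ->
    (forall i, (1 <= i <= n)%nat -> -1 <= beta i <= 1) ->
    (forall i, (i <= n)%nat -> bext n beta i <> bext n beta (S i)) ->
    (forall l, lattice_outer_corner n beta l ->
       exists z, component n V beta l z /\ cusp_param n V beta v0 z)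
    /\
    (exists (ps : list (R * R)) (ls : list nat),
       NoDup ps /\ NoDup ls /\
       (forall p, In p ps <->
          exists z, cusp_param n V beta v0 z /\
                    p = (tau_of n V beta z, chi_of n V beta v0 z)) /\
       (forall l, In l ls <-> lattice_outer_corner n beta l) /\
       length ps = length ls).
Proof.
  intros n V beta v0 Hn HV Hb Hne.
  assert (Hex := component_unique_cusp n V beta v0 Hn HV Hb Hne).
  split.
  { intros l Hl; destruct (Hex l Hl) as (z & H1 & H2 & _); now exists z. }
  set (ls := filter (fun l =>
    if excluded_middle_informative (lattice_outer_corner n beta l) then true else false)
    (seq 0 n)).
  assert (Hls : forall l, In l ls <-> lattice_outer_corner n beta l).
  { intros l; unfold ls; rewrite filter_In, in_seq.
    destruct (excluded_middle_informative (lattice_outer_corner n beta l)) as [H|H].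
    - split; [tauto | intros _; split; [|reflexivity]]; destruct H; lia.
    - split; [intros []; discriminate | tauto]. }
  assert (Hnd : NoDup ls) by apply NoDup_filter, seq_NoDup.
  set (P := fun l p => exists z, component n V beta l z /\ cusp_param n V beta v0 z /\
              p = (tau_of n V beta z, chi_of n V beta v0 z)).
  destruct (list_choice _ _ P ls) as [ps Hps].
  { intros l Hl; destruct (Hex l (proj1 (Hls l) Hl)) as (z & H1 & H2 & _).
    eexists; exists z; eauto. }
  exists ps, ls.
  split; [|split; [exact Hnd | split; [intros p; split | split; [exact Hls|]]]].
  - apply (Forall2_NoDup _ _ P ls ps); auto.
    intros l l' p Hl Hl' (z & Hz & Hc & ->) (z' & Hz' & Hc' & Heq).
    injection Heq as Ht Hx.
    assert (z = z') by (eapply cusp_point_inj; eauto); subst z'.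
    apply (component_disjoint n V beta Hn HV Hb l l' z); auto; now apply Hls.
  - intros Hp; destruct (Forall2_in_r _ _ _ _ _ Hps p Hp) as (l & _ & z & _ & H).
    now exists z.
  - intros (z & Hc & ->).
    destruct (cusp_in_component n V beta v0 Hn HV Hb Hne z Hc) as (l & Hl & Hz).
    destruct (Forall2_in_l _ _ _ _ _ Hps l (proj2 (Hls l) Hl)) as (p & Hp & y & Hy & Hcy & ->).
    (* The point listed for the corner comes with its own parameter [y]; uniqueness on the component
       identifies both [y] and [z] with [u]. *)
    destruct (Hex l Hl) as (u & _ & _ & Hu).
    now rewrite (Hu z Hz Hc), <- (Hu y Hy Hcy).
  - symmetry; eapply Forall2_length, Hps.
Qed.
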